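(* The class of countable Steiner triple systems is faithfully Borel complete; that is, the isomorphism relation $\cong_\Sigma$ on $\mathrm{Mod}(\Sigma)$ is faithfully Borel complete, where $\Sigma$ is the theory of Steiner triple systems. Moreover, there is a faithful Borel reduction $\theta\colon \mathrm{Mod}(\Gamma)\to\mathrm{Mod}(\Sigma)$ from $\cong_\Gamma$ to $\cong_\Sigma$, where $\Gamma$ is the theory of graphs, such that for every countable graph $M$ with universe $\mathbb{N}$, we have $\mathrm{Aut}(\theta(M))\cong\mathrm{Aut}(M)$ (as groups).
   Context: **Borel reducibility.** A standard Borel space is a Polish space equipped just with the $\sigma$-algebra of its Borel sets. Let $E$, $F$ be equivalence relations on standard Borel spaces $X$, $Y$. A Borel reduction from $E$ to $F$ is a Borel function $f\colon X\to Y$ such that for all $x,x'\in X$, $x\,E\,x' \iff f(x)\,F\,f(x')$. A Borel reduction $f$ from $E$ to $F$ is a faithful Borel reduction if for every $E$-invariant Borel set $A\subseteq X$, the $F$-saturation $[f(A)]_F=\{x\in Y\mid x\,F\,y\text{ for some }y\in f(A)\}$ is Borel. **Spaces of countable models.** Let $L=\{R_i\mid i\in I\}$ be a countable relational language ($I$ countable, $R_i$ an $n_i$-ary relation symbol). $\mathrm{Mod}(L)$ is the space of all $L$-structures with universe $\mathbb{N}$, identified with $\prod_{i\in I}\mathcal{P}(\mathbb{N}^{n_i})=\prod_{i\in I}2^{\mathbb{N}^{n_i}}$ with the product topology; it is a standard Borel space. For an $L_{\omega_1,\omega}$-sentence $\sigma$ (countable conjunctions and disjunctions allowed), $\mathrm{Mod}(\sigma)=\{M\in\mathrm{Mod}(L)\mid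 M\models\sigma\}$, a Borel subset of $\mathrm{Mod}(L)$ and hence a standard Borel space, and $\cong_\sigma$ denotes the isomorphism relation on $\mathrm{Mod}(\sigma)$. **Faithful Borel completeness.** An equivalence relation $E$ on a standard Borel space is faithfully Borel complete if for every countable relational language $L$ and every $L_{\omega_1,\omega}$-sentence $\sigma$ there is a faithful Borel reduction from $\cong_\sigma$ to $E$. The class of countable models of $\sigma$ is called faithfully Borel complete if $\cong_\sigma$ is. **Theories.** $\Gamma$ (graphs), in the language with one binary relation symbol $R$, is the conjunction of $\forall x\,\neg R(x,x)$ and $\forall x\forall y\,(R(x,y)\leftrightarrow R(y,x))$. $\Sigma$ (Steiner triple systems), in the language with one ternary relation symbol $E$, is the conjunction of: - $\forall x\forall y\forall z\,\bigl(E(x,y,z)\rightarrow(x\neq y\wedge y\neq z\wedge z\neq x)\bigr)$; - $\forall x\forall y\forall z\,\bigl((E(x,y,z)\leftrightarrow E(y,x,z))\wedge(E(x,y,z)\leftrightarrow E(x,z,y))\bigr)$; - $\forall x\forall y\forall z_1\forall z_2\,\bigl((E(x,y,z_1)\wedge E(x,y,z_2))\rightarrow z_1=z_2\bigr)$; - $\forall x\forall y\,\bigl(x\neq y\rightarrow\exists z\,E(x,y,z)\bigr)$. So a Steiner triple system is a set of points with a collection of 3-element subsets (blocks) such that every two distinct points lie in exactly one block. $\mathrm{Aut}$ denotes the automorphism group of a structure. *)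

(* Defs.v *)
From HB Require Import structures.
From mathcomp Require Import all_boot all_classical all_analysis.

Set Implicit Arguments.
Unset Strict Implicit.
Unset Printing Implicit Defensive.

Local Open Scope classical_set_scope.

Definition borel (T : topologicalType) : set (set T) := <<s @open T >>.

Definition borel_fun (X Y : topologicalType) (f : X -> Y) : Prop :=
  forall B : set Y, borel B -> borel (f @^-1` B).

Definition invariant_set (X : Type) (E : X -> X -> Prop) (A : set X) : Prop :=
  forall x x', E x x' -> A x -> A x'.

Definition saturation (Y : Type) (F : Y -> Y -> Prop) (B : set Y) : set Y :=
  [set y | exists2 z, B z & F y z].

(* Only the Borel sets of [X] and [Y] matter here, not their topologies: a
   standard Borel space is represented by any topological space inducing its
   sigma-algebra, e.g. a Borel subset of a Polish space with the subspace
   topology. *)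
Definition borel_reduction (X Y : topologicalType)
    (E : X -> X -> Prop) (F : Y -> Y -> Prop) (f : X -> Y) : Prop :=
  borel_fun f /\ forall x x', E x x' <-> F (f x) (f x').

Definition faithful_borel_reduction (X Y : topologicalType)
    (E : X -> X -> Prop) (F : Y -> Y -> Prop) (f : X -> Y) : Prop :=
  borel_reduction E F f /\
  forall A : set X, borel A -> invariant_set E A -> borel (saturation F (f @` A)).

Record language := Language { symbol : countType; arity : symbol -> nat }.

Definition structures (L : language) : Type :=
  prod_topology (fun i : symbol L =>
    (prod_topology (fun _ : (arity i).-tuple nat => bool : topologicalType)
     : topologicalType)).

HB.instance Definition _ (L : language) := Topological.on (structures L).

(* [formula L n] is the type of formulas whose free variables are among
   [x_0, ..., x_(n-1)]; a quantifier in a [formula L n] binds [x_n].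
   A sentence has finitely many (bound) variables in scope at each of its
   subformulas, so this loses no sentence. Conjunctions and disjunctions
   range over sequences, finite nonempty ones being obtained by repetition. *)
Inductive formula (L : language) (n : nat) : Type :=
| Rel (i : symbol L) of (arity i).-tuple 'I_n
| Eq of 'I_n & 'I_n
| Not of formula L n
| Conj of (nat -> formula L n)
| Disj of (nat -> formula L n)
| All of formula L n.+1
| Ex of formula L n.+1.

Arguments Eq {L n} & _ _.
Arguments Not {L n} & _.
Arguments All {L n} & _.
Arguments Ex {L n} & _.

Definition sentence (L : language) : Type := formula L 0.

Fixpoint sat (L : language) (M : structures L) (n : nat) (p : formula L n) :
    n.-tuple nat -> Prop :=
  match p with
  | Rel i v => fun e => M i [tuple of map (tnth e) v]
  | Eq x y => fun e => tnth e x = tnth e y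
  | Not q => fun e => ~ sat M q e
  | Conj q => fun e => forall k, sat M (q k) e
  | Disj q => fun e => exists k, sat M (q k) e
  | All q => fun e => forall a, sat M q [tuple of rcons e a]
  | Ex q => fun e => exists a, sat M q [tuple of rcons e a]
  end.

Definition models (L : language) (s : sentence L) : set (structures L) :=
  [set M | sat M s [tuple]].

Section Connectives.
Variables (L : language) (n : nat).
Implicit Types p q : formula L n.

Definition And p q := Conj (fun k => if k is 0 then p else q).
Definition Or p q := Disj (fun k => if k is 0 then p else q).
Definition Imp p q := Or (Not p) q.
Definition Iff p q := And (Imp p q) (Imp q p).
Definition Neq x y : formula L n := Not (Eq x y).

End Connectives.

Arguments And {L n} & p q.
Arguments Or {L n} & p q.
Arguments Imp {L n} & p q.
Arguments Iff {L n} & p q.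
Arguments Neq {L n} & x y.

Definition is_iso (L : language) (M N : structures L) (g : nat -> nat) : Prop :=
  bijective g /\
  forall (i : symbol L) (v : (arity i).-tuple nat),
    M i v = N i [tuple of map g v].

Definition iso (L : language) (s : sentence L) (M N : models s) : Prop :=
  exists g, is_iso (val M) (val N) g.

Definition faithfully_borel_complete (Y : topologicalType) (F : Y -> Y -> Prop)
  : Prop :=
  forall (L : language) (s : sentence L),
    exists f : models s -> Y, faithful_borel_reduction (@iso L s) F f.

Section AutomorphismGroup.
Variables (L : language) (M : structures L).

Definition Aut : Type := [set g | is_iso M M g].

HB.instance Definition _ := Choice.on Aut.

Lemma is_iso_id : is_iso M M id.
Proof.
split; first by exists id.
by move=> i v; congr (@M i _); apply/val_inj; rewrite /= map_id.
Qed.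

Lemma is_iso_comp g h : is_iso M M g -> is_iso M M h -> is_iso M M (g \o h).
Proof.
move=> [bg Mg] [bh Mh]; split; first exact: bij_comp.
move=> i v; rewrite Mh Mg; congr (@M i _); apply/val_inj.
by rewrite /= -map_comp.
Qed.

Lemma is_iso_inv (g : Aut) :
  {h : nat -> nat | cancel h (val g) /\ cancel (val g) h /\ is_iso M M h}.
Proof.
apply: cid; case: (set_valP g) => -[h gK hK] Mg; exists h; do 2!split=> //.
split; first by exists (val g).
move=> i v; rewrite [RHS]Mg; congr (@M i _); apply/val_inj.
by rewrite /= -map_comp (eq_map hK) map_id.
Qed.

Definition aut1 : Aut := SigSub (mem_set is_iso_id).
Definition autM (g h : Aut) : Aut :=
  SigSub (mem_set (is_iso_comp (set_valP g) (set_valP h))).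
Definition autV (g : Aut) : Aut :=
  SigSub (mem_set (proj2 (proj2 (svalP (is_iso_inv g))))).

Lemma autMA : associative autM.
Proof. by move=> f g h; apply/val_inj. Qed.
Lemma aut1M : left_id aut1 autM.
Proof. by move=> f; apply/val_inj. Qed.
Lemma autM1 : right_id aut1 autM.
Proof. by move=> f; apply/val_inj. Qed.
Lemma autVM : left_inverse aut1 autV autM.
Proof.
by move=> f; apply/val_inj/funext => x; apply: (svalP (is_iso_inv f)).2.1.
Qed.
Lemma autMV : right_inverse aut1 autV autM.
Proof.
by move=> f; apply/val_inj/funext => x; apply: (svalP (is_iso_inv f)).1.
Qed.

HB.instance Definition _ := isGroup.Build Aut autMA aut1M autM1 autVM autMV.

End AutomorphismGroup.

Definition group_isomorphic (G H : groupType) : Prop :=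
  exists f : {multiplicative G -> H}, bijective f.

(* The bidirectionality hints here and above propagate the number of variables
   in scope down to ['x_k], so that [k < n] can be checked by computation. *)
Definition var n (k : nat) (k_lt_n : k < n) : 'I_n := Ordinal k_lt_n.
Arguments var {n} & k k_lt_n.
Local Notation "''x_' k" := (var k isT) (at level 8, k at level 2).

Definition graph_language : language := @Language unit (fun=> 2).
Definition steiner_language : language := @Language unit (fun=> 3).

Definition R n (x y : 'I_n) : formula graph_language n :=
  @Rel graph_language n tt [tuple x; y].
Definition E n (x y z : 'I_n) : formula steiner_language n :=
  @Rel steiner_language n tt [tuple x; y; z].

Arguments R {n} & x y.
Arguments E {n} & x y z.

Definition Gamma : sentence graph_language :=
  And (All (Not (R 'x_0 'x_0)))
      (All (All (Iff (R 'x_0 'x_1) (R 'x_1 'x_0)))).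

Definition Sigma : sentence steiner_language :=
  And (All (All (All (Imp (E 'x_0 'x_1 'x_2)
         (And (Neq 'x_0 'x_1) (And (Neq 'x_1 'x_2) (Neq 'x_2 'x_0)))))))
 (And (All (All (All (And (Iff (E 'x_0 'x_1 'x_2) (E 'x_1 'x_0 'x_2))
                          (Iff (E 'x_0 'x_1 'x_2) (E 'x_0 'x_2 'x_1))))))
 (And (All (All (All (All (Imp (And (E 'x_0 'x_1 'x_2) (E 'x_0 'x_1 'x_3))
                               (Eq 'x_2 'x_3))))))
      (All (All (Imp (Neq 'x_0 'x_1) (Ex (E 'x_0 'x_1 'x_2))))))).

(* Main.v *)
Require Import Defs.
From HB Require Import structures.
From mathcomp Require Import all_boot all_classical all_analysis.
From mathcomp Require Import zify.

(** An [L]-structure [M] is coded by a Steiner triple system that is generated as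
    freely as possible by the elements of [M] and the 15 points of a rigid Steiner
    triple system [W]. The only blocks imposed beside those of [W] make
    [(t * a) * (t * b) = c] hold, for two triples [(a, b, c)] of points of [W]: the
    first one is imposed exactly when [t] is an element of [M], the second one when
    [t] spells a tuple of which a relation of [M] is true.

    In the free construction every point that is not a generator lies on at most
    two blocks without larger points. So a largest point of a finite subsystem with
    at least seven points is a generator: [W] is the only copy of itself. For the
    same reason no unintended point outside [W] satisfies the two equations, and [M]
    can be recovered from the triple system by Borel formulas with the points of [W]
    as parameters. Isomorphisms of the triple systems thus fix [W] and are determined
    by isomorphisms of the structures. A triple system [N] is isomorphic to the code
    of a structure in an invariant Borel set [A] if and only if, for some choice of
    15 points of [N], the decoded structure belongs to [A] and the canonical map from
    its code to [N] is an isomorphism: this is a Borel condition on [N]. *)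

Set Implicit Arguments.
Unset Strict Implicit.
Unset Printing Implicit Defensive.

Local Open Scope classical_set_scope.

(** * Borel predicates *)

Section BorelPredicates.
Variable X : topologicalType.
Implicit Types P Q : X -> Prop.

Lemma borel_open (A : set X) : open A -> borel A.
Proof. exact: sub_sigma_algebra. Qed.

Lemma borel_ext P Q : (forall x, P x <-> Q x) -> borel P -> borel Q.
Proof. by move=> PQ; have -> : P = Q by apply/funext => x; apply/propext. Qed.

Lemma borel_not P : borel P -> borel (fun x => ~ P x).
Proof.
move=> /(@sigma_algebraCD _ setT open); apply: borel_ext => x.
by split=> [[]|//].
Qed.

Lemma borel_exists (I : countType) (P : I -> X -> Prop) :
  (forall i, borel (P i)) -> borel (fun x => exists i, P i x).
Proof.
move=> bP; pose F n := if unpickle n is Some i then P i : set X else set0.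
have : borel (\bigcup_n F n).
  apply: (@sigma_algebra_bigcup _ setT open) => n; rewrite /F.
  by case: unpickle => [i|]; [exact: bP | exact: (@sigma_algebra0 _ setT open)].
apply: borel_ext => x; split=> [[n _]|[i Pix]].
  by rewrite /F; case: unpickle => // i; exists i.
by exists (pickle i); rewrite // /F pickleK.
Qed.

Lemma borel_forall (I : countType) (P : I -> X -> Prop) :
  (forall i, borel (P i)) -> borel (fun x => forall i, P i x).
Proof.
move=> bP; have : borel (fun x => ~ exists i, ~ P i x).
  by apply: borel_not; apply: borel_exists => i; apply: borel_not; apply: bP.
apply: borel_ext => x; split=> [nP i|Px [i]]; last by apply.
by apply: contrapT => nPi; apply: nP; exists i.
Qed.

Lemma borel_or P Q : borel P -> borel Q -> borel (fun x => P x \/ Q x).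
Proof.
move=> bP bQ; apply: (@borel_ext (fun x => exists b : bool, if b then P x else Q x)).
  move=> x; split=> [[[]]|[]]; [by left|by right|by exists true|by exists false].
by apply: borel_exists => -[].
Qed.

Lemma borel_and P Q : borel P -> borel Q -> borel (fun x => P x /\ Q x).
Proof.
move=> bP bQ; apply: (@borel_ext (fun x => forall b : bool, if b then P x else Q x)).
  by move=> x; split=> [PQ|[Px Qx] []//]; split; [exact: (PQ true)|exact: (PQ false)].
by apply: borel_forall => -[].
Qed.

Lemma borel_imply P Q : borel P -> borel Q -> borel (fun x => P x -> Q x).
Proof.
move=> bP bQ; apply: (@borel_ext (fun x => ~ P x \/ Q x)); last first.
  by apply: borel_or => //; apply: borel_not.
by move=> x; split=> [[]//|]; case: (pselect (P x)); [right; tauto|left].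
Qed.

Lemma borel_iff P Q : borel P -> borel Q -> borel (fun x => P x <-> Q x).
Proof. by move=> bP bQ; apply: borel_and; apply: borel_imply. Qed.

Lemma borel_const (p : Prop) : borel (fun _ : X => p).
Proof.
have b0 := @sigma_algebra0 _ setT (@open X).
case: (pselect p) => p0; last by apply: borel_ext b0 => x; split.
by apply: borel_ext (borel_not b0) => x; split=> // _ [].
Qed.

Lemma borel_exists_in (I : countType) (Q : I -> Prop) (P : I -> X -> Prop) :
  (forall i, borel (P i)) -> borel (fun x => exists2 i, Q i & P i x).
Proof.
move=> bP; apply: (@borel_ext (fun x => exists i, Q i /\ P i x)).
  by move=> x; split=> [[i []]|[i]]; exists i.
by apply: borel_exists => i; apply: borel_and => //; apply: borel_const.
Qed.

(** For countable [I] this is Borel measurability into the discrete space [I]. Numbers, terms and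
    sequences computed from a point of [X] are handled in this form. *)
Definition borel_val (I : Type) (f : X -> I) := forall i, borel (fun x => f x = i).

(** The space is split into the countably many fibres of [f]. *)
Lemma borel_subst (I : countType) (f : X -> I) (P : I -> X -> Prop) :
  borel_val f -> (forall i, borel (P i)) -> borel (fun x => P (f x) x).
Proof.
move=> bf bP; apply: (@borel_ext (fun x => exists i, f x = i /\ P i x)).
  by move=> x; split=> [[i [<-]]|] //; exists (f x).
by apply: borel_exists => i; apply: borel_and.
Qed.

Lemma borel_val_cst (I : Type) (i : I) : borel_val (fun _ => i).
Proof. by move=> j; apply: (borel_const (i = j)). Qed.

Lemma borel_val_comp (I : countType) (J : Type) (f : X -> I) (g : I -> X -> J) :
  borel_val f -> (forall i, borel_val (g i)) -> borel_val (fun x => g (f x) x).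
Proof.
by move=> bf bg j; apply: (@borel_subst _ _ (fun i x => g i x = j)) => // i; apply: bg.
Qed.

Lemma borel_val_bool (f : X -> bool) : borel f -> borel_val f.
Proof.
move=> bf [] //.
by apply: borel_ext (borel_not bf) => x; split=> [/negP/negbTE|->].
Qed.

(** By uniqueness the fibre over [i] is [P i], enlarged for the default [i0] by the set on which no
    witness exists. *)
Lemma borel_val_xget (I : countType) (i0 : I) (P : I -> X -> Prop) :
  (forall i, borel (P i)) -> (forall x i j, P i x -> P j x -> i = j) ->
  borel_val (fun x => xget i0 [set i | P i x]).
Proof.
move=> bP uP i.
apply: (@borel_ext (fun x => P i x \/ (i = i0 /\ ~ exists j, P j x))); last first.
  apply: borel_or => //; apply: borel_and; first exact: borel_const.
  by apply: borel_not; apply: borel_exists.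
move=> x; split=> [[Pix|[-> nP]]|<-].
- by apply: xget_unique => // j /uP; apply.
- by apply: xgetPN => j Pj; apply: nP; exists j.
- case: xgetP => [j _ Pj|nP]; first by left.
  by right; split=> // -[j /nP].
Qed.

End BorelPredicates.

Lemma borel_fun_open (X Y : topologicalType) (f : X -> Y) :
  (forall B, open B -> borel (f @^-1` B)) -> borel_fun f.
Proof.
move=> of_ B bB; apply: (bB [set B : set Y | borel (f @^-1` B)]); split=> //.
split.
- exact: borel_const.
- move=> A bA; apply: borel_ext (borel_not bA) => x; split; last by case.
  by move=> nA; split.
- move=> A bA; apply: (@borel_ext _ (fun x => exists n, A n (f x))).
    by move=> x; split=> [[n]|[n _]]; exists n.
  by apply: borel_exists => n; apply: bA.
Qed.

(** * Borel sets of a subspace *)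

Section BorelSubspace.
Variables (T : topologicalType) (A : set T).

Lemma borel_fun_val : borel_fun (val : A -> T).
Proof.
apply: borel_fun_open => B oB; apply: borel_open.
by exists B.
Qed.

Lemma borel_fun_sub (X : topologicalType) (f : X -> A) :
  borel_fun (val \o f) -> borel_fun f.
Proof.
move=> bf; apply: borel_fun_open => _ [B oB <-].
by apply: bf; apply: borel_open.
Qed.

(** The traces of Borel sets form a sigma-algebra containing the relatively open sets. *)
Lemma borel_sub_trace (B : set A) :
  borel B -> exists2 B' : set T, borel B' & B = val @^-1` B'.
Proof.
move=> bB; apply: (bB [set B : set A |
  exists2 B' : set T, borel B' & B = val @^-1` B']); split.
  split.
  - by exists set0 => //; apply: borel_const.
  - move=> _ [C bC ->]; exists (~` C); first exact: borel_not.
    by rewrite setTD.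
  - move=> F bF.
    have /choice[G GP] n : exists C : set T, borel C /\ F n = val @^-1` C.
      by have [C bC FC] := bF n; exists C.
    exists (\bigcup_n G n).
      by apply: (@sigma_algebra_bigcup _ setT open) => n; case: (GP n).
    by rewrite preimage_bigcup; apply: eq_bigcupr => n _; case: (GP n).
by move=> _ [C oC <-]; exists C => //; apply: borel_open.
Qed.

Lemma borel_image_val (B : set A) : borel A -> borel B -> borel (val @` B).
Proof.
move=> bA /borel_sub_trace[C bC ->].
apply: borel_ext (borel_and bA bC) => x; split=> [[Ax Cx]|[y Cy <-]].
  by exists (SigSub (mem_set Ax)).
by split=> //; apply: set_valP.
Qed.

End BorelSubspace.

Lemma open_preimage_coordinate (I : Type) (K : I -> topologicalType) (i : I)
  (A : set (K i)) : open A -> open [set f : prod_topology K | A (f i)].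
Proof.
move=> oA; rewrite openE => f Af.
have /cvg_sup/(_ i) : nbhs (f : prod_topology K) --> (f : prod_topology K) by [].
apply; exists [set f : prod_topology K | A (f i)] => //.
by split=> //; exists A.
Qed.

(** * Borel sets of structures *)

Section BorelStructures.
Variable L : language.
Implicit Types M N : structures L.

Definition atom : Type := {i : symbol L & (arity i).-tuple nat}.
HB.instance Definition _ := Countable.on atom.

Definition agree M (a : seq (atom * bool)) : Prop :=
  forall i v b, (Tagged _ v : atom, b) \in a -> M i v = b.

(** The sets containing a finite cylinder around [M] form a filter [F]; that [F] converges to [M] is
    the claim. *)
Lemma open_cylinder (U : set (structures L)) M : open U -> U M ->
  exists2 a, agree M a & [set N | agree N a] `<=` U.
Proof.
move=> oU UM.
pose F : set_system (structures L) :=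
  fun V => exists2 a, agree M a & [set N | agree N a] `<=` V.
have FF : Filter F.
  split.
  - by exists [::].
  - move=> V W [a Ma aV] [b Mb bW]; exists (a ++ b).
      by move=> i v c; rewrite mem_cat => /orP[/Ma|/Mb].
    move=> N /= Nab; split; [apply: aV|apply: bW] => i v c ic;
      by apply: Nab; rewrite mem_cat ic ?orbT.
  - by move=> V W VW [a Ma aV]; exists a => //; apply: subset_trans aV VW.
(* Convergence in a product is tested at each coordinate, first at a symbol, then at a tuple. *)
suff : F --> (M : structures L) by apply; apply: open_nbhs_nbhs.
apply/cvg_sup => i V0 [_ [[B oB <-] BM] BV]; apply: filterS BV _.
pose Y := prod_topology (fun _ : (arity i).-tuple nat => bool : topologicalType).
pose G : set_system Y := fun W => F (fun N => W (N i)).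
have FG : Filter G.
  split; first exact: filterT.
  - by move=> V W FV FW; apply: filterS (filterI FV FW).
  - by move=> V W VW; apply: filterS => N; apply: VW.
suff : G --> (M i : Y) by apply; apply: open_nbhs_nbhs.
apply/cvg_sup => v V' [_ [[C oC <-] CM] CV]; apply: filterS CV _.
exists [:: (Tagged _ v : atom, M i v)].
  move=> j w b; rewrite inE xpair_eqE => /andP[/eqP E /eqP ->].
  exact: (congr1 (fun t : atom => M (tag t) (tagged t)) E).
move=> N /(_ i v (M i v)) /=; rewrite inE eqxx => /(_ isT) NM.
by rewrite /= NM.
Qed.

Lemma borel_atom (i : symbol L) (v : (arity i).-tuple nat) :
  borel (fun M => M i v).
Proof.
apply: borel_open.
pose K := (fun i : symbol L => prod_topology
  (fun _ : (arity i).-tuple nat => bool : topologicalType) : topologicalType).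
apply: (@open_preimage_coordinate _ K i [set f : K i | f v]).
apply: (@open_preimage_coordinate _
  (fun _ : (arity i).-tuple nat => bool : topologicalType) v [set b : bool | b]).
exact: discrete_open.
Qed.

(** There are countably many lists of prescribed atoms, so every open set is a countable union of
    cylinders. *)
Lemma borel_fun_structures (X : topologicalType) (f : X -> structures L) :
  (forall i v, borel (fun x => f x i v)) -> borel_fun f.
Proof.
move=> bf; apply: borel_fun_open => U oU.
apply: (@borel_ext _ (fun x => exists2 a : seq (atom * bool),
    [set N | agree N a] `<=` U & agree (f x) a)).
  move=> x; split=> [[a aU fa]|Ufx]; first exact: aU.
  by have [a] := open_cylinder oU Ufx; exists a.
apply: borel_exists_in => a; do 3!apply: borel_forall => ?.
by apply: borel_imply; [apply: borel_const|apply: borel_val_bool].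
Qed.

Lemma borel_sat n (p : formula L n) e : borel (fun M => sat M p e).
Proof.
elim: p e => {n} [n i v|n x y|n p IH|n p IH|n p IH|n p IH|n p IH] e /=.
- exact: borel_atom.
- exact: borel_const.
- exact: borel_not.
- by apply: borel_forall => k; apply: IH.
- by apply: borel_exists => k; apply: IH.
- by apply: borel_forall => k; apply: IH.
- by apply: borel_exists => k; apply: IH.
Qed.

Lemma borel_models (s : sentence L) : borel (models s).
Proof. exact: borel_sat. Qed.

Lemma is_iso_sat M N g n (p : formula L n) e :
  is_iso M N g -> sat M p e <-> sat N p [tuple of map g e].
Proof.
move=> [[h gK hK] gMN].
have rconsE m (t : m.-tuple nat) b : [tuple of rcons [tuple of map g t] b] =
    [tuple of map g [tuple of rcons t (h b)]].
  by apply/val_inj; rewrite /= map_rcons hK.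
have rconsE' m (t : m.-tuple nat) a : [tuple of map g [tuple of rcons t a]] =
    [tuple of rcons [tuple of map g t] (g a)].
  by apply/val_inj; rewrite /= map_rcons.
elim: p e => {n} [n i v|n x y|n p IH|n p IH|n p IH|n p IH|n p IH] e /=.
- rewrite gMN; suff -> : [tuple of map g [tuple of map (tnth e) v]] =
    [tuple of map (tnth [tuple of map g e]) v] by [].
  apply/val_inj; rewrite /= -map_comp; apply: eq_map => j /=.
  by rewrite tnth_map.
- by rewrite !tnth_map; split=> [->//|/(can_inj gK)].
- by split=> nP P; apply: nP; apply/IH.
- by split=> P k; apply/IH; apply: P.
- by split=> -[k P]; exists k; apply/IH.
- split=> P a; last by apply/IH; rewrite rconsE'; apply: P.
  by rewrite rconsE; apply/IH; apply: P.
- split=> -[a P]; last by exists (h a); apply/IH; rewrite -rconsE.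
  by exists (g a); rewrite -rconsE'; apply/IH.
Qed.

Lemma is_iso_models M N g (s : sentence L) :
  is_iso M N g -> models s M -> models s N.
Proof.
move=> gMN /(is_iso_sat s [tuple] gMN); rewrite /models /=.
by congr (sat _ _ _); apply/val_inj.
Qed.

End BorelStructures.

(** * A rigid Steiner triple system *)

(** Row [i] and column [j] hold the third point of the block through [i] and [j]; the diagonal is
    idempotent. All properties used are verified by computation. *)
Definition wtable : seq (seq nat) :=
 [:: [:: 0; 3; 4; 1; 2; 9; 7; 6; 13; 5; 14; 12; 11; 8; 10];
     [:: 3; 1; 5; 0; 7; 2; 8; 4; 6; 12; 13; 14; 9; 10; 11];
     [:: 4; 5; 2; 6; 0; 1; 3; 9; 14; 7; 12; 13; 10; 11; 8];
     [:: 1; 0; 6; 3; 8; 10; 2; 11; 4; 13; 5; 7; 14; 9; 12];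
     [:: 2; 7; 0; 8; 4; 11; 12; 1; 3; 10; 9; 5; 6; 14; 13];
     [:: 9; 2; 1; 10; 11; 5; 13; 14; 12; 0; 3; 4; 8; 6; 7];
     [:: 7; 8; 3; 2; 12; 13; 6; 0; 1; 14; 11; 10; 4; 5; 9];
     [:: 6; 4; 9; 11; 1; 14; 0; 7; 10; 2; 8; 3; 13; 12; 5];
     [:: 13; 6; 14; 4; 3; 12; 1; 10; 8; 11; 7; 9; 5; 0; 2];
     [:: 5; 12; 7; 13; 10; 0; 14; 2; 11; 9; 4; 8; 1; 3; 6];
     [:: 14; 13; 12; 5; 9; 3; 11; 8; 7; 4; 10; 6; 2; 1; 0];
     [:: 12; 14; 13; 7; 5; 4; 10; 3; 9; 8; 6; 11; 0; 2; 1];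
     [:: 11; 9; 10; 14; 6; 8; 4; 13; 5; 1; 2; 0; 12; 7; 3];
     [:: 8; 10; 11; 9; 14; 6; 5; 12; 0; 3; 1; 2; 7; 13; 4];
     [:: 10; 11; 8; 12; 13; 7; 9; 5; 2; 6; 0; 1; 3; 4; 14]].

Definition wop (i j : nat) : nat := nth 0 (nth [::] wtable i) j.

Definition wblock (i j k : nat) : bool :=
  [&& i < 15, j < 15, i != j & k == wop i j].

Lemma wblock_sym i j k : wblock i j k -> wblock j i k && wblock j k i.
Proof.
case/and4P=> i15 j15 ij /eqP->.
have /allP/(_ i) : all (fun i => all (fun j => (i != j) ==>
    wblock j i (wop i j) && wblock j (wop i j) i) (iota 0 15)) (iota 0 15).
  by vm_compute.
rewrite mem_iota => /(_ i15)/allP/(_ j); rewrite mem_iota => /(_ j15).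
by rewrite ij.
Qed.

Lemma wblockC i j k : wblock i j k -> wblock j i k.
Proof. by case/wblock_sym/andP. Qed.

Lemma wblockR i j k : wblock i j k -> wblock j k i.
Proof. by case/wblock_sym/andP. Qed.

Lemma wblock_fun i j k k' : wblock i j k -> wblock i j k' -> k = k'.
Proof. by case/and4P=> _ _ _ /eqP-> /and4P[_ _ _ /eqP->]. Qed.

Lemma wblock_neq i j k : wblock i j k -> i != j.
Proof. by case/and4P. Qed.

Lemma wblock_lt i j k : wblock i j k -> i < 15.
Proof. by case/and4P. Qed.

Lemma wblock_wop i j : i < 15 -> j < 15 -> i != j -> wblock i j (wop i j).
Proof. by move=> i15 j15 ij; apply/and4P; split. Qed.

(** Three is one more than the number of blocks without larger points on which a non-constant term
    can lie; [wblock_copy] rests on this. *)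
Lemma wblock_three m : m < 15 -> exists j1 k1 j2 k2 j3 k3,
  [/\ wblock m j1 k1, wblock m j2 k2, wblock m j3 k3 &
      uniq [:: j1; k1; j2; k2; j3; k3]].
Proof.
move=> m15; pose pick (s : seq nat) := head 0 [seq j <- iota 0 15 | j \notin s].
pose j1 := pick [:: m]; pose k1 := wop m j1.
pose j2 := pick [:: m; j1; k1]; pose k2 := wop m j2.
pose j3 := pick [:: m; j1; k1; j2; k2]; pose k3 := wop m j3.
exists j1, k1, j2, k2, j3, k3; apply/and4P.
have /allP/(_ m) : all (fun m =>
    let j1 := pick [:: m] in let k1 := wop m j1 in
    let j2 := pick [:: m; j1; k1] in let k2 := wop m j2 in
    let j3 := pick [:: m; j1; k1; j2; k2] in let k3 := wop m j3 in
    [&& wblock m j1 k1, wblock m j2 k2, wblock m j3 k3 &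
      uniq [:: j1; k1; j2; k2; j3; k3]]) (iota 0 15).
  by vm_compute.
by apply; rewrite mem_iota.
Qed.

(** A straight-line program: each pair gives the positions of two earlier entries, whose product is
    appended. *)
Fixpoint grow (p : seq (nat * nat)) (s : seq nat) : seq nat :=
  if p is (a, b) :: p' then grow p' (rcons s (wop (nth 0 s a) (nth 0 s b)))
  else s.

Fixpoint growable (p : seq (nat * nat)) (s : seq nat) : bool :=
  if p is (a, b) :: p' then
    [&& a < size s, b < size s,
      wblock (nth 0 s a) (nth 0 s b) (wop (nth 0 s a) (nth 0 s b)) &
      growable p' (rcons s (wop (nth 0 s a) (nth 0 s b)))]
  else true.

Lemma grow_map (f : nat -> nat) p s :
    (forall i j k, wblock i j k -> wblock (f i) (f j) (f k)) ->
  growable p s -> grow p (map f s) = map f (grow p s).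
Proof.
move=> fW; elim: p s => [//|[a b] p IH] s /= /and4P[sa sb W gp].
rewrite -IH // map_rcons !(nth_map 0) //.
by case/fW/and4P: W => _ _ _ /eqP->.
Qed.

(* The points 0, 1, 2 generate the system, and [wprogram] is a derivation of the
   points 3, ..., 14 in this order; so an endomorphism is determined by the
   images of 0, 1, 2, which leaves 15^3 candidates to test. *)
Definition wprogram : seq (nat * nat) :=
  [:: (0, 1); (0, 2); (1, 2); (2, 3); (1, 4); (3, 4); (0, 5); (3, 5); (4, 5);
      (4, 6); (5, 6); (5, 7)].

Definition endomorphic (s : seq nat) : bool :=
  all (fun i => all (fun j => (i != j) ==>
    wblock (nth 0 s i) (nth 0 s j) (nth 0 s (wop i j))) (iota 0 15)) (iota 0 15).

Definition rigid (s : seq nat) : bool := endomorphic s ==> (s == iota 0 15).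

Lemma wblock_rigid (f : nat -> nat) :
    (forall i j k, wblock i j k -> wblock (f i) (f j) (f k)) ->
  forall i, i < 15 -> f i = i.
Proof.
(* Every point lies on a block, and the points of a block are below 15. *)
move=> fW; have f15 i : i < 15 -> f i < 15.
  move=> i15; have [j [k [_ [_ [_ [_ [W _ _ _]]]]]]] := wblock_three i15.
  exact: wblock_lt (fW _ _ _ W).
(* Run on 0, 1, 2, the program yields 0, ..., 14 in order; run on their images it therefore lists
   all values of [f]. *)
have gE : grow wprogram [:: f 0; f 1; f 2] = map f (iota 0 15).
  by rewrite (@grow_map f wprogram [:: 0; 1; 2]).
have : all (fun x => all (fun y => all (fun z =>
    rigid (grow wprogram [:: x; y; z])) (iota 0 15)) (iota 0 15)) (iota 0 15).
  by vm_compute.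
have i15 i : i < 15 -> i \in iota 0 15 by rewrite mem_iota.
move=> /allP/(_ _ (i15 _ (f15 0 isT)))/allP/(_ _ (i15 _ (f15 1 isT))).
move=> /allP/(_ _ (i15 _ (f15 2 isT))); rewrite gE => /implyP fE i ilt.
have iotaE j : j < 15 -> nth 0 (iota 0 15) j = j by move=> jlt; rewrite nth_iota.
have nthE j : j < 15 -> nth 0 (map f (iota 0 15)) j = f j.
  by move=> jlt; rewrite (nth_map 0) ?size_iota ?iotaE.
(* By the computation, a list of values that preserves blocks is the identity list. *)
suff /fE/eqP mapE : endomorphic (map f (iota 0 15)).
  by rewrite -(nthE _ ilt) mapE iotaE.
apply/allP => j; rewrite mem_iota => jlt; apply/allP => k.
rewrite mem_iota => klt; apply/implyP => jk.
have W := wblock_wop jlt klt jk.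
have wlt := wblock_lt (wblockC (wblockR W)).
by rewrite (nthE _ jlt) (nthE _ klt) (nthE _ wlt); apply: fW.
Qed.

Arguments wop : simpl never.
Arguments wblock : simpl never.

(** * Free terms *)

Inductive term : Type := C of nat | El of nat | J of term & term.

Fixpoint tree_of_term (t : term) : GenTree.tree nat :=
  match t with
  | C k => GenTree.Node 0 [:: GenTree.Leaf k]
  | El x => GenTree.Node 1 [:: GenTree.Leaf x]
  | J t u => GenTree.Node 2 [:: tree_of_term t; tree_of_term u]
  end.

Fixpoint term_of_tree (t : GenTree.tree nat) : term :=
  match t with
  | GenTree.Node 0 [:: GenTree.Leaf k] => C k
  | GenTree.Node 1 [:: GenTree.Leaf x] => El x
  | GenTree.Node 2 [:: t; u] => J (term_of_tree t) (term_of_tree u)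
  | _ => C 0
  end.

Lemma tree_of_termK : cancel tree_of_term term_of_tree.
Proof. by elim=> //= t -> u ->. Qed.

HB.instance Definition _ := Countable.copy term (can_type tree_of_termK).

Fixpoint term_size (t : term) : nat :=
  if t is J t u then (term_size t + term_size u).+1 else 1.

(** Sorting the factors by their codes makes commutativity an equality of terms. *)
Definition join (t u : term) : term :=
  if pickle t < pickle u then J t u else J u t.

Lemma joinC t u : join t u = join u t.
Proof.
by rewrite /join; case: ltngtP => // /(pcan_inj pickleK) ->.
Qed.

Lemma join_inj t u t' u' : join t u = join t' u' ->
  (t = t' /\ u = u') \/ (t = u' /\ u = t').
Proof.
by rewrite /join; do 2!case: ifP => _; case=> -> ->; [left|right|right|left].
Qed.

Lemma join_neqC t u k : join t u <> C k.
Proof. by rewrite /join; case: ifP. Qed.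

Lemma join_neqEl t u x : join t u <> El x.
Proof. by rewrite /join; case: ifP. Qed.

Lemma term_size_join t u : term_size (join t u) = (term_size t + term_size u).+1.
Proof. by rewrite /join; case: ifP => //= _; rewrite addnC. Qed.

Lemma join_injr t u u' : join t u = join t u' -> u = u'.
Proof. by case/join_inj => -[] // -> ->. Qed.

Definition constant (t : term) : Prop := exists k, t = C k.

(* The factor [C 1] separates the letters: without it, a letter followed by itself
   would cancel, since [(t * g) * g = t] in every Steiner triple system. *)
Definition step (t g : term) : term := join (join t g) (C 1).

Definition spell (x : nat) (l : seq term) : term := foldl step (El x) l.

(** The symbol [i] is written in unary. Entries of [v] never equal [C 0], so the prefix can be told
    apart, and its length is positive, so every such list is a [word]. *)
Definition letters (i : nat) (v : seq nat) : seq term :=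
  nseq i.+1 (C 0) ++ map El v.

(* The padding [x] makes the code of a tuple a non-constant term even if the tuple
   is empty. *)
Definition code (i : nat) (v : seq nat) (x : nat) : term := spell x (letters i v).

Definition letter (g : term) : Prop := g = C 0 \/ exists x, g = El x.

(** The shape shared by all partial spellings, hence by all terms that can be marked: no stem is a
    constant, and a compound stem has the factor [C 1]. *)
Definition stem (t : term) : Prop :=
  (exists x, t = El x) \/ exists s g, t = step s g.

Lemma stem_neqC t k : stem t -> t <> C k.
Proof. by move=> [[x ->]|[s [g ->]]] //; apply: join_neqC. Qed.

Lemma spell_stem x l : stem (spell x l).
Proof.
case/lastP: l => [|l g]; first by left; exists x.
by right; rewrite /spell foldl_rcons; exists (spell x l), g.
Qed.

Lemma letter_letters i v g : g \in letters i v -> letter g.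
Proof.
rewrite mem_cat mem_nseq => /orP[/andP[_ /eqP]|/mapP[x _]] ->; first by left.
by right; exists x.
Qed.

(** As [join] is commutative, the stem and the letter can be exchanged, but only if both are
    elements of the structure. *)
Lemma step_inj t g t' g' : stem t -> stem t' -> letter g -> letter g' ->
  step t g = step t' g' ->
  (t = t' /\ g = g') \/ exists x y, [/\ t = El x, g = El y, t' = g & g' = t].
Proof.
move=> st st' lg lg' /join_inj[[]|[/join_neqC]] // /join_inj[[-> ->]|[tg gt']] _.
  by left.
right; case: lg' => [g'0|[x g'x]].
  by case: (stem_neqC st (etrans tg g'0)).
case: lg => [g0|[y gy]]; first by case: (stem_neqC st' (etrans (esym gt') g0)).
by exists x, y; split=> //; rewrite tg.
Qed.

(* Without the condition on the first letter, [spell x [:: El y]] and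
   [spell y [:: El x]] would be the same term. *)
Definition word (l : seq term) : Prop :=
  head (C 0) l = C 0 /\ forall g, g \in l -> letter g.

Lemma word_letters i v : word (letters i v).
Proof. by split=> // g; apply: letter_letters. Qed.

Lemma word_rcons l g : word (rcons l g) -> [/\ word l, letter g & l = [::] -> g = C 0].
Proof.
case=> hd al; split.
- by split; [case: l hd {al} | move=> h hl; apply: al; rewrite mem_rcons inE hl orbT].
- by apply: al; rewrite mem_rcons inE eqxx.
- by move=> l0; move: hd; rewrite l0.
Qed.

Lemma spell_inj x l y l' : word l -> word l' -> spell x l = spell y l' ->
  x = y /\ l = l'.
Proof.
elim/last_ind: l l' => [|l g IH] l'; case/lastP: l' => [|l' g'] //.
- by move=> _ _ [].
- by move=> _ _; rewrite /spell foldl_rcons /= => /esym/join_neqEl.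
- by move=> _ _; rewrite /spell foldl_rcons /= => /join_neqEl.
move=> /word_rcons[wl lg l0] /word_rcons[wl' lg' l0'].
rewrite /spell !foldl_rcons => /step_inj[]; rewrite -?/(spell _ _) //.
- exact: spell_stem.
- exact: spell_stem.
- by move=> [/IH[]// -> -> ->].
(* In the exceptional case the stem is a bare element, so the word has just one letter; this would
   be [C 0] and an element at once. *)
case=> z [w [tz gw _ _]]; case/lastP: l {IH wl} tz l0 => [_ /(_ erefl)|l h].
  by rewrite gw.
by rewrite /spell foldl_rcons => /join_neqEl.
Qed.

Lemma letters_inj i v j w : letters i v = letters j w -> i = j /\ v = w.
Proof.
have El_inj : injective El by move=> ? ? [].
rewrite /letters /= => -[]; elim: i j => [|i IH] [|j] /=.
- by move/(inj_map El_inj) ->.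
- by case: v.
- by case: w {IH}.
- by case=> /IH[-> ->].
Qed.

Lemma code_inj i v x j w y :
  code i v x = code j w y -> [/\ i = j, v = w & x = y].
Proof.
move=> /(spell_inj (word_letters i v) (word_letters j w))[xy].
by move/letters_inj=> [].
Qed.

(** * The triple system on the terms in normal form *)

Section Triples.
Variable R : nat -> seq nat -> Prop.

(* The points 3, ..., 8 of the rigid system play no role in the spelling of codes,
   so that marking a term does not interfere with the products that spell it. *)
Definition mark (t : term) (a b c : nat) : Prop :=
  (exists x, t = El x /\ (a, b, c) \in [:: (3, 4, 5); (4, 3, 5)]) \/
  (exists i v x, [/\ t = code i v x, R i v &
    (a, b, c) \in [:: (6, 7, 8); (7, 6, 8)]]).

(** The imposed blocks. Since [wblock] is symmetric and [mark] is symmetric in [a] and [b], the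
    constructors yield every ordering of the points of a block. *)
Inductive special : term -> term -> term -> Prop :=
| SpecialW i j k of wblock i j k : special (C i) (C j) (C k)
| SpecialM1 t a b c of mark t a b c :
    special (join t (C a)) (join t (C b)) (C c)
| SpecialM2 t a b c of mark t a b c :
    special (join t (C a)) (C c) (join t (C b))
| SpecialM3 t a b c of mark t a b c :
    special (C c) (join t (C a)) (join t (C b)).

(* A join is in normal form if its factors do not lie on a block already. *)
Definition free (x y : term) : Prop :=
  [/\ forall z, ~ special x y z, forall u, x <> join y u &
      forall u, y <> join x u].

Fixpoint valid (t : term) : Prop :=
  match t with
  | C k => k < 15
  | El _ => True
  | J x y => [/\ valid x, valid y, pickle x < pickle y & free x y]
  end.

(** Besides the imposed blocks, each join in normal form is on a block with its factors; the last
    three constructors put the join in each position. *)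
Inductive block : term -> term -> term -> Prop :=
| BlockS x y z of special x y z : block x y z
| BlockJ x y of valid (join x y) : block x y (join x y)
| BlockL x y of valid (join x y) : block (join x y) x y
| BlockR x y of valid (join x y) : block x (join x y) y.

Lemma markC t a b c : mark t a b c -> mark t b a c.
Proof.
move=> [[x [-> m]]|[i [v [x [-> Riv m]]]]]; [left; exists x|right; exists i, v, x];
  split=> //; move: m;
  rewrite !inE !xpair_eqE => /orP[]/andP[/andP[]]/eqP->/eqP->/eqP->;
  by rewrite ?eqxx ?orbT.
Qed.

Lemma mark_stem t a b c : mark t a b c -> stem t.
Proof.
move=> [[x [-> _]]|[i [v [x [-> _ _]]]]]; first by left; exists x.
exact: spell_stem.
Qed.

Lemma mark_index t a b c : mark t a b c ->
  [/\ a \in [:: 3; 4; 6; 7], b \in [:: 3; 4; 6; 7], c \in [:: 5; 8] & a != b].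
Proof.
by move=> [[x [_ m]]|[i [v [x [_ _ m]]]]]; move: m;
  rewrite !inE !xpair_eqE => /orP[]/andP[/andP[]]/eqP->/eqP->/eqP->.
Qed.

Lemma mark_neq t a b c : mark t a b c -> [/\ a <> c, b <> c & a <> b].
Proof.
by move=> [[x [_ m]]|[i [v [x [_ _ m]]]]]; move: m;
  rewrite !inE !xpair_eqE => /orP[]/andP[/andP[]]/eqP->/eqP->/eqP->.
Qed.

(** The four triples in the definition of [mark] have distinct first entries, so [a] alone
    determines [b] and [c]. *)
Lemma mark_fun t a b c b' c' : mark t a b c -> mark t a b' c' -> b = b' /\ c = c'.
Proof.
by move=> [[x [-> m]]|[i [v [x [-> _ m]]]]] [[y [ty m']]|[j [w [y [ty _ m']]]]];
  move: m m'; rewrite !inE !xpair_eqE => /orP[]/andP[/andP[]]/eqP->/eqP->/eqP->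
  /orP[]/andP[/andP[]]/eqP?/eqP->/eqP->.
Qed.

(** A marked term is a stem and no constant, so the factor [C a] can be identified. *)
Lemma mark_join t a b c t' a' b' c' : mark t a b c -> mark t' a' b' c' ->
  join t (C a) = join t' (C a') -> [/\ t = t', a = a', b = b' & c = c'].
Proof.
move=> m m' /join_inj[[tt' [aa']]|[tC _]]; last by case: (stem_neqC (mark_stem m) tC).
by move: m'; rewrite -tt' -aa' => /(mark_fun m)[-> ->].
Qed.

Lemma specialC x y z : special x y z -> special y x z.
Proof.
case=> [i j k /wblockC W|t a b c /markC M|t a b c M|t a b c M].
- exact: SpecialW.
- exact: SpecialM1.
- exact: SpecialM3.
- exact: SpecialM2.
Qed.

Lemma specialR x y z : special x y z -> special y z x.
Proof.
case=> [i j k /wblockR W|t a b c M|t a b c /markC M|t a b c M].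
- exact: SpecialW.
- exact: SpecialM2 (markC M).
- exact: SpecialM3.
- exact: SpecialM1.
Qed.

Lemma special_cases x y z : special x y z ->
  (exists i j k, [/\ x = C i, y = C j, z = C k & wblock i j k]) \/
  exists t a b c, mark t a b c /\
    [\/ [/\ x = join t (C a), y = join t (C b) & z = C c],
        [/\ x = join t (C a), y = C c & z = join t (C b)] |
        [/\ x = C c, y = join t (C a) & z = join t (C b)]].
Proof.
case=> [i j k W|t a b c M|t a b c M|t a b c M]; first by left; exists i, j, k.
- by right; exists t, a, b, c; split=> //; constructor 1.
- by right; exists t, a, b, c; split=> //; constructor 2.
- by right; exists t, a, b, c; split=> //; constructor 3.
Qed.

Lemma special_fun x y z z' : special x y z -> special x y z' -> z = z'.
Proof.
case=> [i j k W|t a b c M|t a b c M|t a b c M] /special_cases[].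
- by move=> [i' [j' [k' [[<-] [<-] -> /(wblock_fun W) ->]]]].
- move=> [t' [a' [b' [c' [_ []]]]]] [].
  + by move/esym/join_neqC.
  + by move/esym/join_neqC.
  + by move=> _ /esym/join_neqC.
- by move=> [i' [j' [k' [/join_neqC]]]].
- move=> [t' [a' [b' [c' [M' []]]]]] [].
  + by move=> /(mark_join M M')[_ _ _ ->] _ ->.
  + by move=> _ /join_neqC.
  + by move/join_neqC.
- by move=> [i' [j' [k' [/join_neqC]]]].
- move=> [t' [a' [b' [c' [M' []]]]]] [].
  + by move=> _ /esym/join_neqC.
  + by move=> /(mark_join M M')[-> _ -> _] _ ->.
  + by move/join_neqC.
- by move=> [i' [j' [k' [_ /join_neqC]]]].
- move=> [t' [a' [b' [c' [M' []]]]]] [].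
  + by move/esym/join_neqC.
  + by move/esym/join_neqC.
  + by move=> _ /(mark_join M M')[-> _ -> _] ->.
Qed.

Lemma special_neq x y z : special x y z -> x <> y.
Proof.
case=> [i j k /wblock_neq/eqP ij|t a b c /mark_neq[_ _ ab]|t a b c _|t a b c _].
- by case.
- by move/join_injr => -[].
- exact: join_neqC.
- by move/esym; apply: join_neqC.
Qed.

(** Ensures that an imposed block never shares two points with a block formed by a join and its
    factors. When [y] is a constant [C c], this depends on [c] being different from the marking
    index [a]. *)
Lemma special_neq_join x y z u : special x y z -> x <> join y u.
Proof.
case=> [i j k _|t a b c _|t a b c M|t a b c _].
- by move/esym; apply: join_neqC.
- by move/(congr1 term_size); rewrite !term_size_join /=; lia.
- case/join_inj => -[tC]; first by case: (stem_neqC (mark_stem M) tC).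
  by case=> ac; case: (mark_neq M).
- by move/esym; apply: join_neqC.
Qed.

Lemma specialS_free x y z : special x y z -> ~ free x y.
Proof. by move=> S [/(_ z)]. Qed.

Lemma freeC x y : free x y -> free y x.
Proof. by case=> nS nx ny; split=> // z /specialC; apply: nS. Qed.

Lemma valid_join x y :
  valid (join x y) <-> [/\ valid x, valid y, x <> y & free x y].
Proof.
rewrite /join; case: ifP => /= [xy|yx].
  split=> [[vx vy _ fxy]|[vx vy _ fxy]]; split=> // e.
  by rewrite e ltnn in xy.
split=> [[vy vx lt fyx]|[vx vy nxy fxy]]; split=> //; try exact: freeC.
  by move=> e; rewrite e ltnn in lt.
rewrite ltn_neqAle leqNgt yx andbT; apply/eqP => /(pcan_inj pickleK) e.
exact: nxy.
Qed.

(** The only constants on an imposed block with non-constant points are 5 and 8. *)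
Lemma special_stemC t k z : stem t -> k \notin [:: 5; 8] -> ~ special t (C k) z.
Proof.
move=> st k58 /special_cases[[i [j [l [tC]]]]|]; first by case: (stem_neqC st tC).
move=> [s [a [b [c [/mark_index[_ _ c58 _] []]]]]] [] tE.
- by move/esym/join_neqC.
- by case=> kc _; rewrite kc c58 in k58.
- by case: (stem_neqC st tE).
Qed.

Lemma special_neqEl t x z : ~ special t (El x) z.
Proof.
move=> /special_cases[[i [j [l [_]]]]|] //.
by move=> [s [a [b [c [_ []]]]]] [] // _ /esym/join_neqEl.
Qed.

(** The index 1 is excluded because [C 1] is a factor of every step and would cancel; 5 and 8
    because they lie on imposed blocks with marked joins. *)
Lemma valid_joinC t k : stem t -> valid t -> k < 15 -> k \notin [:: 1; 5; 8] ->
  valid (join t (C k)).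
Proof.
move=> st vt k15; rewrite inE negb_or => /andP[/eqP k1 k58].
apply/valid_join; split=> //; first exact: stem_neqC.
split; first by move=> z; apply: special_stemC.
- move=> u; case: st => [[x ->] /esym/join_neqEl//|[s [g ->]]].
  by case/join_inj => -[]; [move/join_neqC|move=> _ [] /esym].
- by move=> u /esym/join_neqC.
Qed.

(** A letter is not a join, and neither [C 0] nor [C 1] is the constant on a marked block. Nor can
    the outer [C 1] cancel: neither the stem nor the letter equals [C 1]. *)
Lemma valid_step t g : stem t -> letter g -> valid t -> valid g -> t <> g ->
  valid (step t g).
Proof.
move=> st lg vt vg tg.
have gneq a b : g <> join a b.
  by case: lg => [->|[x ->]] /esym; [apply: join_neqC | apply: join_neqEl].
have g1 : g <> C 1 by case: lg => [->|[x ->]].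
have vj : valid (join t g).
  apply/valid_join; split=> //; split.
  - by move=> z; case: lg => [->|[x ->]]; [apply: special_stemC|apply: special_neqEl].
  - move=> u; case: st => [[x ->] /esym/join_neqEl//|[s [h ->]]].
    by case/join_inj => -[]; [move=> /esym/gneq|move=> _ /esym].
  - by move=> u /gneq.
apply/valid_join; split=> //; first exact: join_neqC.
split.
- move=> z /special_cases[[i [j [l [/join_neqC]]]]//|].
  move=> [s [a [b [c [/mark_index[_ _ c58 _] []]]]]] [] jE.
  + by move/esym/join_neqC.
  + by case=> c1; rewrite -c1 in c58.
  + by move: jE => /join_neqC.
- by move=> u /join_inj[[tC _]|[_]] //; case: (stem_neqC st tC).
- by move=> u /esym/join_neqC.
Qed.

Lemma valid_spell x l : word l -> (forall g, g \in l -> valid g) -> valid (spell x l).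
Proof.
elim/last_ind: l => [//|l g IH] /word_rcons[wl lg l0] vl.
rewrite /spell foldl_rcons -/(spell x l); apply: valid_step => //.
- exact: spell_stem.
- by apply: IH => // h hl; apply: vl; rewrite mem_rcons inE hl orbT.
- by apply: vl; rewrite mem_rcons inE eqxx.
(* The letter must differ from the stem: if it is an element, it is not the first letter, so the
   stem is a join. *)
case: lg => [->|[y gy]]; first exact: stem_neqC (spell_stem _ _).
case/lastP: l l0 {IH wl vl} => [/(_ erefl)|l h _]; first by rewrite gy.
by rewrite gy /spell foldl_rcons => /join_neqEl.
Qed.

Lemma valid_code_term i v x : valid (code i v x).
Proof.
apply: valid_spell; first exact: word_letters.
by move=> g /letter_letters[->|[y ->]].
Qed.

Lemma mark_valid t a b c : mark t a b c -> valid (join t (C a)).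
Proof.
move=> M; have vt : valid t.
  by case: M => [[x [-> _]]|[i [v [x [-> _ _]]]]] //; apply: valid_code_term.
have [a4 _ _ _] := mark_index M.
by apply: valid_joinC (mark_stem M) vt _ _; move: a4;
  rewrite !inE => /or4P[]/eqP->.
Qed.

Lemma special_valid x y z : special x y z -> valid x.
Proof.
case=> [i j k /wblock_lt|t a b c /mark_valid|t a b c /mark_valid|
  t a b c /mark_index[_ _]] //.
by rewrite !inE => /orP[]/eqP->.
Qed.

Lemma blockC x y z : block x y z -> block y x z.
Proof.
case=> [{}x {}y {}z /specialC S|{}x {}y V|{}x {}y V|{}x {}y V].
- exact: BlockS.
- by rewrite joinC in V *; apply: BlockJ.
- exact: BlockR.
- exact: BlockL.
Qed.

Lemma blockR x y z : block x y z -> block y z x.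
Proof.
case=> [{}x {}y {}z /specialR S|{}x {}y V|{}x {}y V|{}x {}y V].
- exact: BlockS.
- by rewrite joinC in V *; apply: BlockR.
- exact: BlockJ.
- by rewrite joinC in V *; apply: BlockL.
Qed.

Lemma block_valid x y z : block x y z -> valid x.
Proof.
by case=> [{}x {}y {}z /special_valid|{}x {}y /valid_join[]|//|{}x {}y /valid_join[]].
Qed.

Lemma block_neq x y z : block x y z -> x <> y.
Proof.
case=> [{}x {}y {}z /special_neq|{}x {}y /valid_join[]|{}x {}y _|{}x {}y _] //.
- by move/(congr1 term_size); rewrite term_size_join; lia.
- by move/(congr1 term_size); rewrite term_size_join; lia.
Qed.

Lemma block_cases x y z : block x y z ->
  [\/ special x y z, valid (join x y) /\ z = join x y,
     valid (join y z) /\ x = join y z | valid (join x z) /\ y = join x z].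
Proof.
case=> [{}x {}y {}z|{}x {}y|{}x {}y|{}x {}y];
  by [constructor 1|constructor 2|constructor 3|constructor 4].
Qed.

(** The two blocks are compared by kind. The conditions in [free] and [special_neq_join] exclude
    different kinds, and sizes exclude that each of two points is a join with the other as a
    factor. *)
Lemma block_fun x y z z' : block x y z -> block x y z' -> z = z'.
Proof.
case=> [{}x {}y {}z S|{}x {}y V|{}x {}y V|{}x {}y V] /block_cases[].
- exact: special_fun S.
- by move=> [/valid_join[_ _ _ /(specialS_free S)]].
- by move=> [_] /(special_neq_join S).
- by move=> [_] /(special_neq_join (specialC S)).
- by move=> S; case/valid_join: V => _ _ _ /(specialS_free S).
- by case.
- by move=> [_ E]; case/valid_join: V => _ _ _ [_ /(_ z')].
- by move=> [_ E]; case/valid_join: V => _ _ _ [_ _ /(_ z')].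
- by move=> /special_neq_join/(_ erefl).
- by move=> [/valid_join[_ _ _ [_ /(_ y)]]].
- by move=> [_ /join_injr].
- move=> [_ /(congr1 term_size)]; rewrite !term_size_join; lia.
- by move=> /specialC/special_neq_join/(_ erefl).
- by move=> [/valid_join[_ _ _ [_ _ /(_ y)]]].
- move=> [_ /(congr1 term_size)]; rewrite !term_size_join; lia.
- by move=> [_ /join_injr].
Qed.

Lemma block_exists x y : valid x -> valid y -> x <> y -> exists z, block x y z.
Proof.
move=> vx vy xy; have [fxy|nfxy] := pselect (free x y).
  by exists (join x y); apply: BlockJ; apply/valid_join.
apply: contrapT => nb; apply: nfxy; split.
- by move=> z S; apply: nb; exists z; apply: BlockS.
- by move=> u xE; apply: nb; exists u; rewrite xE; apply: BlockL; rewrite -xE.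
- by move=> u yE; apply: nb; exists u; rewrite yE; apply: BlockR; rewrite -yE.
Qed.

(** On a block of any other kind, [y] or [z] is a join with factor [m], hence larger than [m]. *)
Lemma block_low m y z : block m y z ->
  term_size y <= term_size m -> term_size z <= term_size m ->
  m = join y z \/ special m y z.
Proof.
move=> /block_cases[S|[_ ->]|[_ ->]|[_ ->]] ; rewrite ?term_size_join; try lia.
  by right.
by left.
Qed.

(** By [mark_join], a non-constant point is a marked join in only one way. With [block_low] this
    leaves at most two blocks through [m] without larger points. *)
Lemma special_pair m y z y' z' : ~ constant m -> special m y z -> special m y' z' ->
  (y = y' /\ z = z') \/ (y = z' /\ z = y').
Proof.
move=> nm S S'.
suff nrm x w : special m x w -> exists t a b c, mark t a b c /\
    [/\ m = join t (C a) & (x = C c /\ w = join t (C b)) \/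
      (x = join t (C b) /\ w = C c)].
  have [t [a [b [c [M [mE xw]]]]]] := nrm _ _ S.
  have [t' [a' [b' [c' [M' [mE' xw']]]]]] := nrm _ _ S'.
  have [tt aa bb cc] := mark_join M M' (etrans (esym mE) mE').
  subst t' a' b' c'.
  by case: xw => -[-> ->]; case: xw' => -[-> ->]; [left|right|right|left].
move=> /special_cases[[i [j [k [mC]]]]|[t [a [b [c [M []]]]]] [mE xE wE]].
- by case: nm; exists i.
- by exists t, a, b, c; do 2!split=> //; right.
- by exists t, a, b, c; do 2!split=> //; left.
- by case: nm; exists c.
Qed.

(** Two distinct constants already lie on a block of the rigid system, so their join is not in
    normal form. *)
Lemma block_CC i j z : block (C i) (C j) z -> exists2 k, z = C k & wblock i j k.
Proof.
move=> B; have /block_cases[] := B.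
- move=> /special_cases[[i' [j' [k [[->] [->] -> W]]]]|]; first by exists k.
  move=> [t [a [b [c [M []]]]]] [].
  + by move/esym/join_neqC.
  + by move/esym/join_neqC.
  + by move=> _ /esym/join_neqC.
- move=> [/valid_join[i15 j15 ij [nS _ _]] _]; case: (nS (C (wop i j))).
  by apply/SpecialW/wblock_wop => //; apply/eqP => ij'; rewrite ij' in ij.
- by move=> [_ /esym/join_neqC].
- by move=> [_ /esym/join_neqC].
Qed.

Lemma special_El x y z : ~ special (El x) y z.
Proof. by move/specialC/special_neqEl. Qed.

(* A point of maximal size in a copy of the rigid system lies on three blocks of
   the copy, whereas a non-constant point lies on at most two blocks without
   larger points; so the copy consists of constants. *)
Lemma wblock_copy (f : nat -> term) :
    (forall i j k, wblock i j k -> block (f i) (f j) (f k)) ->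
  forall i, i < 15 -> f i = C i.
Proof.
move=> fB; have f_inj i j : i < 15 -> j < 15 -> f i = f j -> i = j.
  move=> i15 j15 fij; apply/eqP/negPn/negP => ij.
  exact: block_neq (fB _ _ _ (wblock_wop i15 j15 ij)) fij.
have [m m15 mmax] : exists2 m, m < 15 &
    forall i, i < 15 -> term_size (f i) <= term_size (f m).
  have [m _ mmax] := @arg_maxnP 'I_15 ord0 xpredT (fun i => term_size (f i)) isT.
  by exists m => // i i15; apply: (mmax (Ordinal i15)).
have wlt i j k : wblock i j k -> [/\ i < 15, j < 15 & k < 15].
  move=> W; split; [exact: wblock_lt W|exact: wblock_lt (wblockC W)|].
  exact: wblock_lt (wblockR (wblockR W)).
have fm1 : term_size (f m) = 1.
  case fmE: (f m) => [//|//|t u]; exfalso.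
  have nm : ~ constant (f m) by rewrite fmE => -[].
  have [j1 [k1 [j2 [k2 [j3 [k3 [W1 W2 W3 U]]]]]]] := wblock_three m15.
  have low j k : wblock m j k -> f m = join (f j) (f k) \/ special (f m) (f j) (f k).
    move=> W; have [_ j15 k15] := wlt _ _ _ W.
    by apply: block_low (fB _ _ _ W) _ _; apply: mmax.
  have same j k j' k' : wblock m j k -> wblock m j' k' ->
      uniq [:: j; k; j'; k'] ->
      (f j = f j' /\ f k = f k') \/ (f j = f k' /\ f k = f j') -> False.
    move=> W W' U'; have [_ j15 k15] := wlt _ _ _ W.
    have [_ j15' k15'] := wlt _ _ _ W'.
    move: U'; rewrite /= !inE !negb_or -!andbA => /and4P[_ /eqP jj' /eqP jk' _].
    by case=> -[/f_inj jE _]; [apply: jj'|apply: jk']; apply: jE.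
  have jj j k j' k' : f m = join (f j) (f k) -> f m = join (f j') (f k') ->
      (f j = f j' /\ f k = f k') \/ (f j = f k' /\ f k = f j').
    by move=> -> /join_inj.
  have U12 : uniq [:: j1; k1; j2; k2].
    by apply: subseq_uniq U; apply: (@prefix_subseq _ _ [:: j3; k3]).
  have U23 : uniq [:: j2; k2; j3; k3].
    by apply: subseq_uniq U; apply: (@suffix_subseq _ [:: j1; k1]).
  have U13 : uniq [:: j1; k1; j3; k3].
    apply: subseq_uniq U; exact: (mask_subseq
      [:: true; true; false; false; true; true] [:: j1; k1; j2; k2; j3; k3]).
  (* Of the three blocks through [f m], two are of the same kind and hence coincide, against
     injectivity. *)
  case: (low _ _ W1) (low _ _ W2) (low _ _ W3) => S1 [] S2 [] S3.
  - exact: same W1 W2 U12 (jj _ _ _ _ S1 S2).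
  - exact: same W1 W2 U12 (jj _ _ _ _ S1 S2).
  - exact: same W1 W3 U13 (jj _ _ _ _ S1 S3).
  - exact: same W2 W3 U23 (special_pair nm S2 S3).
  - exact: same W2 W3 U23 (jj _ _ _ _ S2 S3).
  - exact: same W1 W3 U13 (special_pair nm S1 S3).
  - exact: same W1 W2 U12 (special_pair nm S1 S2).
  - exact: same W1 W2 U12 (special_pair nm S1 S2).
(* All points now have size 1. An element lies on no such block, as it is neither a join nor on an
   imposed block. *)
have fC i : i < 15 -> constant (f i).
  move=> i15; have [j [k [_ [_ [_ [_ [W _ _ _]]]]]]] := wblock_three i15.
  have [_ j15 k15] := wlt _ _ _ W.
  have sz l : l < 15 -> term_size (f l) <= 1.
    by move=> l15; rewrite -fm1; apply: mmax.
  have := sz _ i15; case fiE: (f i) => [l|x|t u] /=; first by exists l.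
    have := fB _ _ _ W; rewrite fiE => /block_low[] /=; try exact: sz.
      by move/esym/join_neqEl.
    by move/special_El.
  by case: (t) => [?|?|? ?] /=; lia.
(* The copy lies in the subsystem of constants, so it is given by a map on indices, to which
   rigidity applies. *)
pose g i := if f i is C k then k else 0.
have fg i : i < 15 -> f i = C (g i) by move=> /fC[k fk]; rewrite /g fk.
move=> i i15; rewrite fg // (@wblock_rigid g) // => {i i15} i j k W.
have [i15 j15 k15] := wlt _ _ _ W.
have := fB _ _ _ W; rewrite !fg // => /block_CC[l [->]].
by [].
Qed.

Lemma special_C m k n : ~ constant m -> special m (C k) n ->
  exists t a b, mark t a b k /\ m = join t (C a) /\ n = join t (C b).
Proof.
move=> nm /special_cases[[i [j [l [mC]]]]|[t [a [b [c [M []]]]]] [mE kE nE]].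
- by case: nm; exists i.
- by case: (join_neqC (esym kE)).
- by case: kE => ->; exists t, a, b.
- by case: nm; exists c.
Qed.

(** Neither block has a point larger than [m]. They cannot both come from factoring [m], nor both be
    imposed, since the constants [k] and [k'] differ; comparing the factorization of [m] with the
    imposed block reveals the mark. *)
Lemma block_top m n n' k k' : ~ constant m -> ~ constant n -> ~ constant n' ->
    k <> k' -> block m (C k) n -> block m (C k') n' ->
    term_size n <= term_size m -> term_size n' <= term_size m ->
  (exists2 b, mark n k b k' & n' = join n (C b)) \/
  (exists2 b, mark n' k' b k & n = join n' (C b)).
Proof.
have sz1 t : 0 < term_size t by case: t.
have main m0 n0 n0' k0 k0' : ~ constant m0 -> ~ constant n0 ->
    m0 = join (C k0) n0 -> special m0 (C k0') n0' ->
    exists2 b, mark n0 k0 b k0' & n0' = join n0 (C b).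
  move=> cm cn mE /(special_C cm)[t [a [b [M [mE' nE]]]]].
  move: mE; rewrite mE' => /join_inj[[tC _]|[tn [ak]]].
    by case: (stem_neqC (mark_stem M) tC).
  by exists b; rewrite -?tn -?ak.
move=> cm cn cn' kk' B B' s s'.
case: (block_low B (sz1 _) s) => H; case: (block_low B' (sz1 _) s') => H'.
- move: H'; rewrite H => /join_inj[[[]]//|[kn _]].
  by case: cn'; exists k.
- by left; apply: main cm cn H H'.
- by right; apply: main cm cn' H' H.
- case: (special_pair cm H H') => [[[]]//|[kn _]].
  by case: cn'; exists k.
Qed.

(** The converse of imposing blocks: no unintended point satisfies the equation. [block_top] is
    applied at a largest vertex of the triangle [y], [u], [v]. If this is [y], or if the mark sits
    on the wrong vertex, then [a] or [b] would be 5 or 8. *)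
Lemma triangle_mark y u v a b c : ~ constant y ->
    a \notin [:: 5; 8] -> b \notin [:: 5; 8] -> a <> b -> c <> a -> c <> b ->
    block y (C a) u -> block y (C b) v -> block u v (C c) ->
  mark y a b c.
Proof.
move=> cy a58 b58 ab ca cb Bu Bv Buv.
have cu : ~ constant u.
  move=> [d uE]; rewrite uE in Bu; have /block_CC[k yE _] := blockR Bu.
  by case: cy; exists k.
have cv : ~ constant v.
  move=> [d vE]; rewrite vE in Bv; have /block_CC[k yE _] := blockR Bv.
  by case: cy; exists k.
have n58 t k k' d : d \notin [:: 5; 8] -> ~ mark t k k' d.
  by move=> d58 /mark_index[_ _ dd _]; rewrite dd in d58.
have Buv1 := blockR (blockC Buv); have Buv2 := blockR Buv.
have fin w k d t : mark t k d c -> block t (C w) (join t (C d)) -> w = d.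
  move=> /markC/mark_valid V B.
  by case: (block_fun (blockC (blockR (blockR B))) (BlockR V)).
have : [\/ term_size u <= term_size y /\ term_size v <= term_size y,
    term_size y <= term_size u /\ term_size v <= term_size u |
    term_size y <= term_size v /\ term_size u <= term_size v].
  have [uy|yu] := leqP (term_size u) (term_size y).
    have [vy|yv] := leqP (term_size v) (term_size y); first by constructor 1.
    by constructor 3; split; lia.
  have [vu|uv] := leqP (term_size v) (term_size u).
    by constructor 2; split; lia.
  by constructor 3; split; lia.
case=> -[s s'].
- by case: (block_top cy cu cv ab Bu Bv s s') => -[k /n58].
- have Buc : block u (C c) v by exact: Buv1.
  case: (block_top cu cy cv (nesym ca) (blockC (blockR Bu)) Buc s s') => -[k M].
    by move=> vE; rewrite vE in Bv; rewrite (fin _ _ _ _ M Bv).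
  by case: (n58 _ _ _ _ a58 M).
- have Bvc : block v (C c) u by exact: Buv2.
  case: (block_top cv cy cu (nesym cb) (blockC (blockR Bv)) Bvc s s') => -[k M].
    by move=> uE; rewrite uE in Bu; rewrite (fin _ _ _ _ M Bu); apply: markC.
  by case: (n58 _ _ _ _ b58 M).
Qed.

End Triples.

(** * Steiner triple systems on the natural numbers *)

Section Enumeration.
Variable D : nat -> Prop.

Definition rank (m : nat) : nat := count (fun k => `[< D k >]) (iota 0 m).

Definition enumerate (n : nat) : nat := xget 0 [set m | D m /\ rank m = n].

Lemma rankS m : rank m.+1 = rank m + `[< D m >].
Proof. by rewrite /rank -addn1 iotaD count_cat /= add0n addn0. Qed.

Lemma rank_le m m' : m <= m' -> rank m <= rank m'.
Proof.
elim: m' => [|m' IH]; first by rewrite leqn0 => /eqP->.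
rewrite leq_eqVlt ltnS => /orP[/eqP->//|/IH/leq_trans]; apply.
by rewrite rankS leq_addr.
Qed.

Lemma rank_inj m m' : D m -> D m' -> rank m = rank m' -> m = m'.
Proof.
suff lt a b : D a -> a < b -> rank a < rank b.
  move=> Dm Dm' E; have [|/lt|//] := ltngtP m m'.
    by move/(lt _ _ Dm); rewrite E ltnn.
  by move/(_ Dm'); rewrite E ltnn.
move=> Da /rank_le; apply: leq_trans.
by rewrite rankS (asboolT Da) addn1.
Qed.

Lemma rank_enumerate m : D m -> enumerate (rank m) = m.
Proof.
move=> Dm; apply: xget_unique => [|k [Dk]]; first by split.
exact: rank_inj.
Qed.

Hypothesis D_unbounded : forall n, exists2 m, n <= m & D m.

Lemma enumerateP n : D (enumerate n) /\ rank (enumerate n) = n.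
Proof.
apply: (@xgetPex _ 0 [set m | D m /\ rank m = n]).
have ex : exists m, n < rank m.
  elim: n => [|n [m nm]].
    have [m _ Dm] := D_unbounded 0; exists m.+1.
    by rewrite rankS (asboolT Dm) addn1.
  have [k mk Dk] := D_unbounded m; exists k.+1; rewrite rankS (asboolT Dk).
  by rewrite addn1 ltnS (leq_trans nm) // rank_le.
(* The least number of rank above [n] is positive, since [rank 0 = 0]; its predecessor is the point
   sought. *)
case: (ex_minnP ex) => -[//|m]; rewrite rankS => nm mmin; exists m => /=.
have mn : rank m <= n by rewrite leqNgt; apply/negP => /mmin; rewrite ltnn.
by case: asboolP nm => [Dm|_]; [split=> //|]; lia.
Qed.

Lemma enumerate_in n : D (enumerate n). Proof. by case: (enumerateP n). Qed.

Lemma enumerateK : cancel enumerate rank.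
Proof. by move=> n; case: (enumerateP n). Qed.

End Enumeration.

Lemma injective_unbounded (D : nat -> Prop) (f : nat -> nat) :
  injective f -> (forall x, D (f x)) -> forall n, exists2 m, n <= m & D m.
Proof.
move=> fI Df n; apply: contrapT => nD.
have lt x : f x < n.
  by rewrite ltnNge; apply/negP => nf; apply: nD; exists (f x).
have : size (map f (iota 0 n.+1)) <= size (iota 0 n).
  apply: uniq_leq_size; first by rewrite map_inj_uniq ?iota_uniq.
  by move=> _ /mapP[x _ ->]; rewrite mem_iota /= add0n.
by rewrite size_map !size_iota ltnn.
Qed.

(** * Models of [Sigma] and their binary operation *)

Definition triple (N : structures steiner_language) (x y z : nat) : bool :=
  N tt [tuple x; y; z].

Definition steiner (N : structures steiner_language) : Prop :=
  [/\ forall x y z, triple N x y z -> x <> y,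
      forall x y z, triple N x y z -> triple N y x z,
      forall x y z, triple N x y z -> triple N y z x,
      forall x y z z', triple N x y z -> triple N x y z' -> z = z' &
      forall x y, x <> y -> exists z, triple N x y z].

Section Sat.
Variables (L : language) (M : structures L) (n : nat).
Implicit Types (p q : formula L n) (e : n.-tuple nat).

Lemma sat_And p q e : sat M (And p q) e <-> sat M p e /\ sat M q e.
Proof. by split=> [s|[s t] [|k]] //; split; [exact: (s 0)|exact: (s 1)]. Qed.

Lemma sat_Imp p q e : sat M (Imp p q) e <-> (sat M p e -> sat M q e).
Proof.
split=> [[[|k]] /= s|pq] //.
by case: (pselect (sat M p e)) => s; [exists 1; apply: pq|exists 0].
Qed.

Lemma sat_Iff p q e : sat M (Iff p q) e <-> (sat M p e <-> sat M q e).
Proof. by rewrite sat_And !sat_Imp. Qed.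

End Sat.

Lemma sat_E N n (x y z : 'I_n) e :
  sat N (E x y z) e <-> triple N (tnth e x) (tnth e y) (tnth e z).
Proof.
rewrite /triple; suff <- : [tuple of map (tnth e) [tuple x; y; z]] =
  [tuple tnth e x; tnth e y; tnth e z] by [].
exact/val_inj.
Qed.

Lemma sat_ImpE N n (x y z : 'I_n) (q : formula steiner_language n) e :
  sat N (Imp (E x y z) q) e ->
  triple N (tnth e x) (tnth e y) (tnth e z) -> sat N q e.
Proof. by move=> /sat_Imp h t; apply/h/sat_E. Qed.

Lemma sat_IffE N n (x y z x' y' z' : 'I_n) e :
  sat N (Iff (E x y z) (E x' y' z')) e ->
  triple N (tnth e x) (tnth e y) (tnth e z) ->
  triple N (tnth e x') (tnth e y') (tnth e z').
Proof. by move=> /sat_Iff[h _] t; apply/sat_E/h/sat_E. Qed.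

Lemma models_SigmaP N : models Sigma N <-> steiner N.
Proof.
rewrite /models /= /Sigma; split.
  move=> /sat_And[s1 /sat_And[s2 /sat_And[s3 s4]]].
  have c x y z : triple N x y z -> triple N y x z.
    by have /sat_And[h _] := s2 x y z; apply: (sat_IffE h).
  have r x y z : triple N x y z -> triple N x z y.
    by have /sat_And[_ h] := s2 x y z; apply: (sat_IffE h).
  split=> //.
  - by move=> x y z t; have /sat_And[] := sat_ImpE (s1 x y z) t.
  - by move=> x y z /c/r.
  - move=> x y z z' t t'; have /sat_Imp := s3 x y z z'; apply.
    by apply/sat_And; split; apply/sat_E.
  - move=> x y xy; have /sat_Imp := s4 x y; case=> // z /sat_E t.
    by exists z.
case=> neq c r f ex; apply/sat_And; split; last (apply/sat_And; split;
  last (apply/sat_And; split)).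
- move=> x y z; apply/sat_Imp => /sat_E t.
  apply/sat_And; split; first exact: neq t.
  by apply/sat_And; split; [exact: neq (r _ _ _ t)|exact: neq (r _ _ _ (r _ _ _ t))].
- move=> x y z; apply/sat_And; split; apply/sat_Iff; split=> /sat_E t; apply/sat_E.
  + exact: c.
  + exact: c.
  + exact: c (r _ _ _ (r _ _ _ t)).
  + exact: c (r _ _ _ (r _ _ _ t)).
- move=> x y z z'; apply/sat_Imp => /sat_And[/sat_E t /sat_E t'].
  exact: f t t'.
- move=> x y; apply/sat_Imp => xy; have [|z t] := ex x y; first exact: xy.
  by exists z; apply/sat_E.
Qed.

(* [op N x y] is the third point of the block through [x] and [y]; no triple
   contains [x] twice, so that [xget] returns its default value on the diagonal. *)
HB.lock Definition op (N : structures steiner_language) (x y : nat) : nat :=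
  xget x [set z | triple N x y z].

Section Operation.
Variable N : structures steiner_language.
Hypothesis sN : steiner N.

Lemma opP x y z : triple N x y z -> op N x y = z.
Proof.
case: sN => _ _ _ f _ t; rewrite op.unlock; apply: xget_unique => // z' t'.
exact: f t' t.
Qed.

Lemma op_triple x y : x <> y -> triple N x y (op N x y).
Proof. by case: sN => _ _ _ _ ex /ex[z t]; rewrite (opP t). Qed.

Lemma opxx x : op N x x = x.
Proof. by case: sN => neq _ _ _ _; rewrite op.unlock; apply: xgetPN => z /neq. Qed.

Lemma opC x y : op N x y = op N y x.
Proof.
have [->//|/eqP/op_triple t] := eqVneq x y.
by apply/esym/opP; case: sN => _ c _ _ _; apply: c.
Qed.

Lemma opR x y z : op N x y = z -> op N y z = x.
Proof.
have [<-|/eqP/op_triple t] := eqVneq x y; first by rewrite opxx => <-; rewrite opxx.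
by move=> <-; apply: opP; case: sN => _ _ r _ _; apply: r.
Qed.

Lemma triple_op x y z : triple N x y z = (x != y) && (op N x y == z).
Proof.
apply/idP/andP => [t|[/eqP xy /eqP <-]]; last exact: op_triple.
by rewrite (opP t) eqxx; split=> //; case: sN => neq _ _ _ _; apply/eqP/(neq _ _ _ t).
Qed.

End Operation.

Lemma is_iso_op N N' g : steiner N -> steiner N' -> is_iso N N' g ->
  forall x y, g (op N x y) = op N' (g x) (g y).
Proof.
move=> sN sN' [bg gN] x y.
have tg a b c : triple N a b c = triple N' (g a) (g b) (g c).
  by rewrite /triple gN; congr (N' tt _); apply/val_inj.
have [->|/eqP xy] := eqVneq x y; first by rewrite !opxx.
by apply/esym/opP => //; rewrite -tg; apply: op_triple.
Qed.

Lemma tripleE N (v : 3.-tuple nat) : N tt v =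
  triple N (tnth v ord0) (tnth v (inord 1)) (tnth v (inord 2)).
Proof.
congr (N tt _); apply/eq_from_tnth => i; apply: esym.
rewrite (tnth_nth 0) /=; case: i => -[|[|[|//]]] i3 /=;
  by congr tnth; apply/val_inj; rewrite /= ?inordK.
Qed.

Lemma op_is_iso N N' g : steiner N -> steiner N' -> bijective g ->
  (forall x y, g (op N x y) = op N' (g x) (g y)) -> is_iso N N' g.
Proof.
move=> sN sN' bg gop; split=> // -[] v.
refine (etrans (tripleE N v) (etrans _ (esym (tripleE N' (map_tuple g v))))).
by rewrite !triple_op // !tnth_map -gop !(inj_eq (bij_inj bg)).
Qed.

(** * The coding *)

Definition eqn (N : structures steiner_language) (d : nat -> nat)
  (a b c t : nat) : Prop := op N (op N t (d a)) (op N t (d b)) = d c.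

Definition opcode (N : structures steiner_language) (d : nat -> nat)
    (i : nat) (v : seq nat) (x : nat) : nat :=
  foldl (fun t g => op N (op N t g) (d 1)) x (nseq i.+1 (d 0) ++ v).

Lemma opcode_hom N N' (h d d' : nat -> nat) i v x :
  (forall x y, h (op N x y) = op N' (h x) (h y)) -> h (d 0) = d' 0 -> h (d 1) = d' 1 ->
  h (opcode N d i v x) = opcode N' d' i (map h v) (h x).
Proof.
move=> hop h0 h1; rewrite /opcode -h0.
have -> : nseq i.+1 (h (d 0)) ++ map h v = map h (nseq i.+1 (d 0) ++ v).
  by rewrite map_cat map_nseq.
elim: (nseq _ _ ++ v) x => //= g l IH x.
by rewrite IH !hop h1.
Qed.

Section Evaluation.
Variables (N : structures steiner_language) (d e : nat -> nat).
Hypothesis sN : steiner N.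

Fixpoint eval (t : term) : nat :=
  match t with
  | C k => d k
  | El x => e x
  | J t u => op N (eval t) (eval u)
  end.

Lemma eval_join t u : eval (join t u) = op N (eval t) (eval u).
Proof. by rewrite /join; case: ifP => _ //=; rewrite opC. Qed.

Lemma eval_code i v x : eval (code i v x) = opcode N d i (map e v) (e x).
Proof.
rewrite /code /spell /opcode.
have -> : nseq i.+1 (d 0) ++ map e v = map eval (letters i v).
  by rewrite /letters map_cat map_nseq -map_comp.
rewrite -[e x]/(eval (El x)); elim: (letters i v) (El x) => //= g l IH t.
by rewrite IH !eval_join.
Qed.

(** The defining relations of the code: under these, evaluation of terms respects blocks. *)
Definition models_diagram (R : nat -> seq nat -> Prop) : Prop :=
  [/\ forall i j k, wblock i j k -> op N (d i) (d j) = d k,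
      forall x, eqn N d 3 4 5 (e x) &
      forall i v x, R i v -> eqn N d 6 7 8 (opcode N d i (map e v) (e x))].

Variable R : nat -> seq nat -> Prop.
Hypothesis NR : models_diagram R.

Lemma eval_mark t a b c : mark R t a b c ->
  op N (op N (eval t) (d a)) (op N (eval t) (d b)) = d c.
Proof.
case: NR => _ eqe eqR [[x [-> m]]|[i [v [x [-> Riv m]]]]]; move: m;
  rewrite !inE !xpair_eqE => /orP[]/andP[/andP[]]/eqP->/eqP->/eqP->.
- exact: eqe.
- by rewrite opC //; apply: eqe.
- by rewrite eval_code; apply: eqR.
- by rewrite opC // eval_code; apply: eqR.
Qed.

Lemma eval_block x y z : block R x y z -> op N (eval x) (eval y) = eval z.
Proof.
case=> [{}x {}y {}z S|{}x {}y _|{}x {}y _|{}x {}y _]; last first.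
- by rewrite eval_join; apply: opR => //; rewrite opC.
- by rewrite eval_join; do 2!apply: opR => //.
- by rewrite eval_join.
case: S => [i j k W|t a b c /eval_mark M|t a b c /eval_mark M|t a b c /eval_mark M].
- by case: NR => /(_ _ _ _ W).
- by rewrite !eval_join.
- by rewrite !eval_join /=; apply: opR => //; rewrite opC.
- by rewrite !eval_join /=; do 2!apply: opR => //.
Qed.

End Evaluation.

(** * The code of a family of relations *)

Definition valid_code (R : nat -> seq nat -> Prop) (k : nat) : Prop :=
  exists2 t, pickle t = k & valid R t.

(** The universe has to be [nat], so the points are the terms in normal form, numbered in the order
    of their [pickle] codes. There are infinitely many, as all [El x] are valid; the default [C 0]
    does not arise. *)
HB.lock Definition nth_term (R : nat -> seq nat -> Prop) (n : nat) : term :=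
  odflt (C 0) (unpickle (enumerate (valid_code R) n)).

HB.lock Definition term_index (R : nat -> seq nat -> Prop) (t : term) : nat :=
  rank (valid_code R) (pickle t).

Section Theta.
Variable R : nat -> seq nat -> Prop.
Local Notation nth_term := (nth_term R).
Local Notation term_index := (term_index R).

Lemma valid_code_unbounded n : exists2 m, n <= m & valid_code R m.
Proof.
apply: (@injective_unbounded _ (fun x => pickle (El x))).
  by move=> x y /(pcan_inj pickleK)[].
by move=> x; exists (El x).
Qed.

Lemma nth_termP n :
  valid R (nth_term n) /\ pickle (nth_term n) = enumerate (valid_code R) n.
Proof.
have [t tE vt] := enumerate_in valid_code_unbounded n.
by rewrite nth_term.unlock -tE pickleK.
Qed.

Lemma nth_term_valid n : valid R (nth_term n).
Proof. by case: (nth_termP n). Qed.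

Lemma nth_termK : cancel nth_term term_index.
Proof.
move=> n; rewrite term_index.unlock (nth_termP n).2 enumerateK //.
exact: valid_code_unbounded.
Qed.

Lemma term_indexK t : valid R t -> nth_term (term_index t) = t.
Proof.
move=> vt; rewrite nth_term.unlock term_index.unlock rank_enumerate ?pickleK //.
by exists t.
Qed.

Definition theta : structures steiner_language :=
  fun _ (v : 3.-tuple nat) => `[< block R (nth_term (nth 0 v 0))
    (nth_term (nth 0 v 1)) (nth_term (nth 0 v 2)) >].

Lemma triple_theta x y z :
  triple theta x y z <-> block R (nth_term x) (nth_term y) (nth_term z).
Proof. by split=> [/asboolP|t] //; apply/asboolP. Qed.

Lemma steiner_theta : steiner theta.
Proof.
split.
- by move=> x y z /triple_theta/block_neq xy e; apply: xy; rewrite e.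
- by move=> x y z /triple_theta/blockC t; apply/triple_theta.
- by move=> x y z /triple_theta/blockR t; apply/triple_theta.
- move=> x y z z' /triple_theta t /triple_theta t'.
  by rewrite -[z]nth_termK (block_fun t t') nth_termK.
- move=> x y xy; have [||E|z B] := @block_exists R (nth_term x) (nth_term y).
  + exact: nth_term_valid.
  + exact: nth_term_valid.
  + by apply: xy; rewrite -[x]nth_termK E nth_termK.
  + exists (term_index z); apply/triple_theta; rewrite term_indexK //.
    exact: block_valid (blockR (blockR B)).
Qed.

Local Notation mul := (op theta).

Lemma op_block x y : x <> y ->
  block R (nth_term x) (nth_term y) (nth_term (mul x y)).
Proof. by move=> /(op_triple steiner_theta)/triple_theta. Qed.

Lemma block_op t u w : block R t u w ->
  mul (term_index t) (term_index u) = term_index w.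
Proof.
move=> B; apply: (opP steiner_theta); apply/triple_theta.
rewrite !term_indexK //; [|exact: block_valid (blockC B)|exact: block_valid B].
exact: block_valid (blockR (blockR B)).
Qed.

Definition cst (k : nat) : nat := term_index (C k).
Definition elt (x : nat) : nat := term_index (El x).

Lemma nth_term_cst k : k < 15 -> nth_term (cst k) = C k.
Proof. exact: (@term_indexK (C k)). Qed.

Lemma nth_term_elt x : nth_term (elt x) = El x.
Proof. exact: (@term_indexK (El x)). Qed.

Lemma eval_theta t : valid R t -> eval theta cst elt t = term_index t.
Proof.
elim: t => //= t IHt u IHu V; have [vt vu lt _] := V.
rewrite IHt // IHu //; have jE : J t u = join t u by rewrite /join lt.
by rewrite jE; apply: block_op; apply: BlockJ; rewrite -jE.
Qed.

Lemma opcode_theta i v x :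
  opcode theta cst i (map elt v) (elt x) = term_index (code i v x).
Proof.
by rewrite -eval_code ?eval_theta //; [apply: valid_code_term|apply: steiner_theta].
Qed.

Lemma nth_term_neq y k : k < 15 -> y <> cst k -> nth_term y <> C k.
Proof.
by move=> k15 yk yE; apply: yk; rewrite -[y]nth_termK yE.
Qed.

Lemma eqn_theta y a b c : (forall k, k < 15 -> y <> cst k) ->
    a \notin [:: 5; 8] -> b \notin [:: 5; 8] -> a <> b -> c <> a -> c <> b ->
    a < 15 -> b < 15 -> c < 15 ->
  eqn theta cst a b c y <-> mark R (nth_term y) a b c.
Proof.
move=> cy a58 b58 ab ca cb a15 b15 c15; rewrite /eqn.
have ncy : ~ constant (nth_term y).
  move=> [k yE]; have := nth_term_valid y; rewrite yE => k15.
  exact: (nth_term_neq k15 (cy _ k15) yE).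
split=> [E|M].
  have := op_block (cy _ a15); have := op_block (cy _ b15).
  rewrite (nth_term_cst a15) (nth_term_cst b15) => Bb Ba.
  apply: (triangle_mark ncy a58 b58 ab ca cb Ba Bb).
  (* Equal products would by idempotence be the constant [c], and then [y] itself would be a
     constant. *)
  rewrite -(nth_term_cst c15) -E; apply: op_block => uv.
  have uc : mul y (cst a) = cst c by rewrite -E -uv opxx //; apply: steiner_theta.
  move: Ba; rewrite uc (nth_term_cst c15) => /blockR/block_CC[k yE _].
  by apply: ncy; exists k.
have yE := nth_termK y; set t := nth_term y in M yE *.
have ja : mul y (cst a) = term_index (join t (C a)).
  by rewrite -yE; apply: block_op; apply: BlockJ; apply: mark_valid M.
have jb : mul y (cst b) = term_index (join t (C b)).
  by rewrite -yE; apply: block_op; apply: BlockJ; apply: mark_valid (markC M).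
by rewrite ja jb; apply: block_op; apply: BlockS; apply: SpecialM1.
Qed.

Lemma elt_neq_cst x k : k < 15 -> elt x <> cst k.
Proof. by move=> k15 /(congr1 nth_term); rewrite nth_term_elt (nth_term_cst k15). Qed.

(** Recovers the elements from the constants: 3 and 4 mark nothing but elements. *)
Lemma theta_elt y :
  (forall k, k < 15 -> y <> cst k) /\ eqn theta cst 3 4 5 y <-> exists x, y = elt x.
Proof.
split=> [[cy /(eqn_theta cy)[]//]|[x ->]].
- by move=> [x [yE _]]; exists x; rewrite -[y]nth_termK yE.
- by move=> [i [v [x [_ _]]]].
have cx k : k < 15 -> elt x <> cst k by apply: elt_neq_cst.
split=> //; apply/eqn_theta => //; rewrite nth_term_elt.
by left; exists x.
Qed.

Lemma nth_term_code i v x : nth_term (term_index (code i v x)) = code i v x.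
Proof. by rewrite term_indexK //; apply: valid_code_term. Qed.

(** Recovers the relations: 6 and 7 mark only codes, and a code determines its symbol and tuple,
    whatever the padding [x]. *)
Lemma theta_rel i v x :
  eqn theta cst 6 7 8 (opcode theta cst i (map elt v) (elt x)) <-> R i v.
Proof.
have cc k : k < 15 -> term_index (code i v x) <> cst k.
  move=> k15 /(congr1 nth_term); rewrite nth_term_code (nth_term_cst k15).
  exact: stem_neqC (spell_stem _ _).
rewrite opcode_theta; split=> [/(eqn_theta cc)[]//|Riv].
- by move=> [y [_]].
- by move=> [j [w [y []]]]; rewrite nth_term_code => /code_inj[-> -> _].
apply/eqn_theta => //; rewrite nth_term_code; right.
by exists i, v, x; split.
Qed.

Lemma theta_wblock i j k : wblock i j k -> mul (cst i) (cst j) = cst k.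
Proof. by move=> W; apply: block_op; apply: BlockS; apply: SpecialW. Qed.

Lemma theta_rigid (f : nat -> nat) :
    (forall i j k, wblock i j k -> triple theta (f i) (f j) (f k)) ->
  forall i, i < 15 -> f i = cst i.
Proof.
move=> fW i i15.
have fE : nth_term (f i) = C i.
  apply: (@wblock_copy R (fun j => nth_term (f j))) => // j k l.
  by move=> /fW/triple_theta.
by rewrite -[f i]nth_termK fE.
Qed.

(** The code is generated by the constants and the elements, by induction on normal forms. *)
Lemma theta_ext (h h' : nat -> nat) N :
    (forall x y, h (mul x y) = op N (h x) (h y)) ->
    (forall x y, h' (mul x y) = op N (h' x) (h' y)) ->
    (forall k, k < 15 -> h (cst k) = h' (cst k)) ->
    (forall x, h (elt x) = h' (elt x)) ->
  h =1 h'.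
Proof.
move=> hop hop' hc he n; rewrite -[n]nth_termK.
elim: (nth_term n) (nth_term_valid n) => [k /hc|x _|t IHt u IHu V] //.
  exact: he.
have [vt vu lt _] := V; have jE : J t u = join t u by rewrite /join lt.
have -> : term_index (J t u) = mul (term_index t) (term_index u).
  by rewrite jE; apply/esym/block_op; apply: BlockJ; rewrite -jE.
by rewrite hop hop' IHt // IHu.
Qed.

End Theta.

(** * The universal property of the code *)

Section ThetaHom.
Variables (R : nat -> seq nat -> Prop) (N : structures steiner_language).
Variables (d e : nat -> nat).
Hypotheses (sN : steiner N) (NR : models_diagram N d e R).

Definition theta_hom (n : nat) : nat := eval N d e (nth_term R n).

Lemma theta_hom_op x y :
  theta_hom (op (theta R) x y) = op N (theta_hom x) (theta_hom y).
Proof.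
have [->|/eqP xy] := eqVneq x y; first by rewrite !opxx //; apply: steiner_theta.
by rewrite /theta_hom (eval_block sN NR (op_block R xy)).
Qed.

Lemma theta_hom_cst k : k < 15 -> theta_hom (cst R k) = d k.
Proof. by move=> k15; rewrite /theta_hom (nth_term_cst _ k15). Qed.

Lemma theta_hom_elt x : theta_hom (elt R x) = e x.
Proof. by rewrite /theta_hom nth_term_elt. Qed.

End ThetaHom.

(** * Elements and relations in an isomorphic copy of the code *)

Section ThetaIso.
Variables (R : nat -> seq nat -> Prop) (N : structures steiner_language).
Variables (g d : nat -> nat).
Hypotheses (sN : steiner N) (gN : is_iso (theta R) N g).
Hypothesis gd : forall k, k < 15 -> d k = g (cst R k).

Let gop := is_iso_op (steiner_theta R) sN gN.
Let g_inj : injective g := bij_inj gN.1.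

Lemma iso_eqn a b c y : a < 15 -> b < 15 -> c < 15 ->
  eqn N d a b c (g y) <-> eqn (theta R) (cst R) a b c y.
Proof.
move=> a15 b15 c15; rewrite /eqn !gd // -!gop.
by split=> [/g_inj|->].
Qed.

Lemma iso_elt y : (forall k, k < 15 -> y <> d k) /\ eqn N d 3 4 5 y <->
  exists x, y = g (elt R x).
Proof.
have [g' _ g'K] := gN.1; rewrite -(g'K y) iso_eqn //; split=> [[cy E]|[x /g_inj yE]].
  have [|x ->] := (theta_elt R (g' y)).1; last by exists x.
  by split=> // k k15 yk; case: (cy k k15); rewrite yk gd.
have [cy E] := (theta_elt R (g' y)).2 (ex_intro _ x yE).
by split=> // k k15; rewrite gd // => /g_inj; apply: cy.
Qed.

Lemma iso_rel i v x :
  eqn N d 6 7 8 (opcode N d i (map (g \o elt R) v) (g (elt R x))) <-> R i v.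
Proof.
rewrite map_comp -(@opcode_hom (theta R) N g (cst R)) ?gd //.
by rewrite iso_eqn //; apply: theta_rel.
Qed.

End ThetaIso.

(** * Isomorphisms of structures and of their codes *)

Definition rel_iso (R R' : nat -> seq nat -> Prop) (f : nat -> nat) : Prop :=
  bijective f /\ forall i v, R i v <-> R' i (map f v).

Definition lift (R R' : nat -> seq nat -> Prop) (f : nat -> nat) : nat -> nat :=
  theta_hom R (theta R') (cst R') (elt R' \o f).

(** An isomorphism of codes maps elements to elements, by [restrictP], so the default 0 does not
    arise for it. *)
Definition restrict (R R' : nat -> seq nat -> Prop) (g : nat -> nat) (x : nat) : nat :=
  if nth_term R' (g (elt R x)) is El y then y else 0.

Section Lift.
Variables (R R' : nat -> seq nat -> Prop) (f : nat -> nat).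
Hypothesis fR : rel_iso R R' f.

Lemma theta_models_diagram :
  models_diagram (theta R') (cst R') (elt R' \o f) R.
Proof.
split.
- exact: theta_wblock.
- by move=> x; case: ((theta_elt R' (elt R' (f x))).2 (ex_intro _ (f x) erefl)).
- by move=> i v x Riv; rewrite map_comp; apply/theta_rel/(fR.2 i v).1.
Qed.

Lemma lift_op x y : lift R R' f (op (theta R) x y) =
  op (theta R') (lift R R' f x) (lift R R' f y).
Proof. exact: theta_hom_op (steiner_theta R') theta_models_diagram _ _. Qed.

Lemma lift_cst k : k < 15 -> lift R R' f (cst R k) = cst R' k.
Proof. exact: theta_hom_cst. Qed.

Lemma lift_elt x : lift R R' f (elt R x) = elt R' (f x).
Proof. exact: theta_hom_elt. Qed.

End Lift.

Lemma rel_iso_sym R R' f f' : rel_iso R R' f -> cancel f f' -> cancel f' f ->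
  rel_iso R' R f'.
Proof.
move=> [_ fR] fK f'K; split; first by exists f.
by move=> i v; rewrite fR -map_comp (eq_map f'K) map_id.
Qed.

(** The lift of the inverse is the inverse of the lift, since both composites are the identity on
    generators. *)
Lemma lift_is_iso R R' f : rel_iso R R' f -> is_iso (theta R) (theta R') (lift R R' f).
Proof.
move=> fR; have [f' fK f'K] := fR.1; have f'R := rel_iso_sym fR fK f'K.
apply: op_is_iso (steiner_theta R) (steiner_theta R') _ (lift_op fR).
exists (lift R' R f') => n.
- apply: (@theta_ext R (lift R' R f' \o lift R R' f) id (theta R)) => //=.
  + by move=> x y; rewrite (lift_op fR) (lift_op f'R).
  + by move=> k k15; rewrite !lift_cst.
  + by move=> x; rewrite !lift_elt fK.
- apply: (@theta_ext R' (lift R R' f \o lift R' R f') id (theta R')) => //=.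
  + by move=> x y; rewrite (lift_op f'R) (lift_op fR).
  + by move=> k k15; rewrite !lift_cst.
  + by move=> x; rewrite !lift_elt f'K.
Qed.

Section Restrict.
Variables (R R' : nat -> seq nat -> Prop) (g : nat -> nat).
Hypothesis gR : is_iso (theta R) (theta R') g.

(** The image of the rigid system is a copy of it in [theta R'], and there is only one. *)
Lemma iso_cst k : k < 15 -> g (cst R k) = cst R' k.
Proof.
apply: (@theta_rigid R' (g \o cst R)) => i j l W /=.
have gop := is_iso_op (steiner_theta R) (steiner_theta R') gR.
rewrite triple_op; last exact: steiner_theta.
rewrite -gop (theta_wblock R W) eqxx andbT (inj_eq (bij_inj gR.1)).
apply/eqP => /(congr1 (nth_term R)).
rewrite (nth_term_cst _ (wblock_lt W)) (nth_term_cst _ (wblock_lt (wblockC W))).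
by case=> ij; have := wblock_neq W; rewrite ij eqxx.
Qed.

Lemma restrictP x : g (elt R x) = elt R' (restrict R R' g x).
Proof.
have gc k : k < 15 -> cst R' k = g (cst R k) by move=> /iso_cst.
have [y yE] : exists y, g (elt R x) = elt R' y.
  apply/theta_elt/(iso_elt (steiner_theta R') gR gc).
  by exists x.
by rewrite /restrict yE nth_term_elt.
Qed.

End Restrict.

Lemma elt_inj R : injective (elt R).
Proof. by move=> x y /(congr1 (nth_term R)); rewrite !nth_term_elt => -[]. Qed.

Lemma is_iso_inverse (L : language) (M N : structures L) g g' :
  is_iso M N g -> cancel g g' -> cancel g' g -> is_iso N M g'.
Proof.
move=> [_ gM] gK g'K; split; first by exists g.
move=> i v; rewrite gM; congr (@N i _); apply/val_inj.
by rewrite /= -map_comp (eq_map g'K) map_id.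
Qed.

Lemma restrict_rel_iso R R' g : is_iso (theta R) (theta R') g ->
  rel_iso R R' (restrict R R' g).
Proof.
move=> gR; have [g' gK g'K] := gR.1; have g'R := is_iso_inverse gR gK g'K.
split.
  exists (restrict R' R g') => x.
    by apply: (@elt_inj R); rewrite -(restrictP g'R) -(restrictP gR) gK.
  by apply: (@elt_inj R'); rewrite -(restrictP gR) -(restrictP g'R) g'K.
move=> i v; have gc k : k < 15 -> cst R' k = g (cst R k) by move=> /(iso_cst gR).
(* Any element can serve as padding; 0 is chosen. *)
rewrite -(iso_rel (steiner_theta R') gR gc i v 0).
rewrite (eq_map (restrictP gR)) (restrictP gR) map_comp.
exact: theta_rel.
Qed.

Lemma lift_restrict R R' g : is_iso (theta R) (theta R') g ->
  lift R R' (restrict R R' g) =1 g.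
Proof.
move=> gR; have rR := restrict_rel_iso gR.
apply: (@theta_ext R _ _ (theta R')).
- exact: lift_op.
- exact: is_iso_op (steiner_theta R) (steiner_theta R') gR.
- by move=> k k15; rewrite lift_cst // (iso_cst gR).
- by move=> x; rewrite lift_elt (restrictP gR).
Qed.

Lemma restrict_lift R R' f : restrict R R' (lift R R' f) =1 f.
Proof. by move=> x; rewrite /restrict lift_elt nth_term_elt. Qed.

(** * The coding is Borel *)

Section RelationOfStructure.
Variable L : language.
Implicit Types M : structures L.

(** Symbols become numbers and tuples become sequences, so that the coding avoids dependent arities
    and is uniform in the language. *)
Definition rel_of M (i : nat) (v : seq nat) : Prop :=
  exists s : symbol L, exists w : (arity s).-tuple nat,
    [/\ pickle s = i, tval w = v & M s w].

Lemma rel_of_pickle M (s : symbol L) (w : (arity s).-tuple nat) :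
  rel_of M (pickle s) w <-> M s w.
Proof.
split=> [[s' [w' [/(pcan_inj pickleK) ss']]]|Msw]; last by exists s, w.
by subst s' => /val_inj ->.
Qed.

Lemma is_iso_rel_of M M' f : is_iso M M' f <-> rel_iso (rel_of M) (rel_of M') f.
Proof.
split=> [[bf fM]|[bf fR]]; split=> //.
  move=> i v; split=> [[s [w [si wv Msw]]]|[s [w' [si w'E M'sw]]]].
    exists s, [tuple of map f w]; split=> //; first by rewrite /= wv.
    by rewrite -fM.
  have sv : size v == arity s by rewrite -(size_map f) -w'E size_tuple.
  exists s, (Tuple sv); split=> //; rewrite fM.
  by congr (is_true (M' s _)): M'sw; apply/val_inj; rewrite /= w'E.
move=> s w; apply/idP/idP => /rel_of_pickle.
  by move/fR => H; apply/rel_of_pickle.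
by move=> H; apply/rel_of_pickle/fR.
Qed.

End RelationOfStructure.

Section BorelConjunctions.
Variable X : topologicalType.

Lemma borel_and3 (P Q S : X -> Prop) : borel P -> borel Q -> borel S ->
  borel (fun x => [/\ P x, Q x & S x]).
Proof.
move=> bP bQ bS; apply: borel_ext (borel_and bP (borel_and bQ bS)) => x.
by split=> [[? []]|[]].
Qed.

Lemma borel_and4 (P Q S T : X -> Prop) : borel P -> borel Q -> borel S -> borel T ->
  borel (fun x => [/\ P x, Q x, S x & T x]).
Proof.
move=> bP bQ bS bT.
apply: borel_ext (borel_and bP (borel_and bQ (borel_and bS bT))) => x.
by split=> [[? [? []]]|[]].
Qed.

Lemma borel_asbool (P : X -> Prop) : borel P -> borel (fun x => `[< P x >]).
Proof. by apply: borel_ext => x; split=> /asboolP. Qed.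

Lemma borel_rank (D : X -> nat -> Prop) m : (forall k, borel (D^~ k)) ->
  borel_val (fun x => rank (D x) m).
Proof.
move=> bD; elim: m => [|m IH]; first exact: borel_val_cst.
have -> : (fun x => rank (D x) m.+1) = (fun x => rank (D x) m + `[< D x m >]).
  by apply/funext => x; rewrite rankS.
apply: (borel_val_comp (g := fun i x => i + `[< D x m >])) => // i.
apply: (borel_val_comp (f := fun x => `[< D x m >])
  (g := fun b x => i + nat_of_bool b)).
  by apply: borel_val_bool; apply: borel_asbool.
by move=> b; apply: borel_val_cst.
Qed.

Lemma borel_enumerate (D : X -> nat -> Prop) n : (forall k, borel (D^~ k)) ->
  borel_val (fun x => enumerate (D x) n).
Proof.
move=> bD; apply: (@borel_val_xget _ _ 0 (fun m x => D x m /\ rank (D x) m = n)).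
  by move=> m; apply: borel_and => //; apply: borel_rank.
by move=> x i j [Di ri] [Dj rj]; apply: (rank_inj Di Dj); rewrite ri rj.
Qed.

End BorelConjunctions.

(** Restates the inductive predicate with countable quantifiers, from which Borelness can be read
    off. *)
Lemma specialP R x y z : special R x y z <->
  (exists i j k, [/\ x = C i, y = C j, z = C k & wblock i j k]) \/
  exists t a b c, mark R t a b c /\
    [\/ [/\ x = join t (C a), y = join t (C b) & z = C c],
        [/\ x = join t (C a), y = C c & z = join t (C b)] |
        [/\ x = C c, y = join t (C a) & z = join t (C b)]].
Proof.
split; first exact: special_cases.
case=> [[i [j [k [-> -> -> W]]]]|[t [a [b [c [M []]]]]] [-> -> ->]].
- exact: SpecialW.
- exact: SpecialM1.
- exact: SpecialM2.
- exact: SpecialM3.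
Qed.

Lemma blockP R x y z : block R x y z <->
  [\/ special R x y z, valid R (join x y) /\ z = join x y,
     valid R (join y z) /\ x = join y z | valid R (join x z) /\ y = join x z].
Proof.
split; first exact: block_cases.
case=> [S|[V ->]|[V ->]|[V ->]].
- exact: BlockS.
- exact: BlockJ.
- exact: BlockL.
- exact: BlockR.
Qed.

Section BorelTheta.
Variables (X : topologicalType) (R : X -> nat -> seq nat -> Prop).
Hypothesis bR : forall i v, borel (fun x => R x i v).

Lemma borel_mark t a b c : borel (fun x => mark (R x) t a b c).
Proof.
apply: borel_or; first exact: borel_const.
do 3!apply: borel_exists => ?.
by apply: borel_and3 => //; apply: borel_const.
Qed.

Lemma borel_special t u w : borel (fun x => special (R x) t u w).
Proof.
apply: borel_ext (fun x => iff_sym (specialP (R x) t u w)) _.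
apply: borel_or; first exact: borel_const.
do 4!apply: borel_exists => ?.
by apply: borel_and; [apply: borel_mark|apply: borel_const].
Qed.

Lemma borel_valid t : borel (fun x => valid (R x) t).
Proof.
elim: t => [k|k|t IHt u IHu] /=; try exact: borel_const.
apply: borel_and4 => //; first exact: borel_const.
apply: borel_and3; [|exact: borel_const|exact: borel_const].
by apply: borel_forall => z; apply: borel_not; apply: borel_special.
Qed.

Lemma borel_block t u w : borel (fun x => block (R x) t u w).
Proof.
apply: (@borel_ext _ (fun x => special (R x) t u w \/
  ((valid (R x) (join t u) /\ w = join t u) \/
  ((valid (R x) (join u w) /\ t = join u w) \/
   (valid (R x) (join t w) /\ u = join t w))))).
  move=> x; apply: iff_trans (iff_sym (blockP (R x) t u w)).
  by split=> [[|[|[]]]|[]]; by [constructor 1|constructor 2|constructor 3|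
    constructor 4|left|right; left|right; right; left|right; right; right].
apply: borel_or; first exact: borel_special.
by do 2!try apply: borel_or; apply: borel_and;
  (exact: borel_valid || exact: borel_const).
Qed.

Lemma borel_nth_term n : borel_val (fun x => nth_term (R x) n).
Proof.
have -> : (fun x => nth_term (R x) n) =
    fun x => odflt (C 0) (unpickle (enumerate (valid_code (R x)) n)).
  by apply/funext => x; rewrite nth_term.unlock.
apply: (@borel_val_comp _ _ _ (fun x => enumerate (valid_code (R x)) n)
  (fun k _ => odflt (C 0) (unpickle k))); last by move=> k; apply: borel_val_cst.
apply: borel_enumerate => k; apply: borel_exists_in => t.
exact: borel_valid.
Qed.

Lemma borel_triple_theta a b c : borel (fun x => triple (theta (R x)) a b c).
Proof.
apply: borel_asbool => /=.
apply: (borel_subst (P := fun t x => block (R x) t _ _) (borel_nth_term a)) => t.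
apply: (borel_subst (P := fun u x => block (R x) t u _) (borel_nth_term b)) => u.
apply: (borel_subst (P := fun w x => block (R x) t u w) (borel_nth_term c)) => w.
exact: borel_block.
Qed.

Lemma borel_fun_theta : borel_fun (fun x => theta (R x)).
Proof.
apply: borel_fun_structures => -[] v.
have := borel_triple_theta (nth 0 v 0) (nth 0 v 1) (nth 0 v 2).
by apply: borel_ext => x.
Qed.

End BorelTheta.

(** * The coding is a faithful reduction *)

Lemma is_iso_trans (L : language) (M N P : structures L) g h :
  is_iso M N g -> is_iso N P h -> is_iso M P (h \o g).
Proof.
move=> [bg gM] [bh hN]; split; first exact: bij_comp.
move=> i v; rewrite gM hN; congr (@P i _); apply/val_inj.
by rewrite /= map_comp.
Qed.

Lemma triple_is_iso N N' g : bijective g ->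
  (forall x y z, triple N x y z <-> triple N' (g x) (g y) (g z)) -> is_iso N N' g.
Proof.
move=> bg gN; split=> // -[] v.
refine (etrans (tripleE N v) (etrans _ (esym (tripleE N' (map_tuple g v))))).
by rewrite !tnth_map; apply/idP/idP => /gN.
Qed.

Lemma is_iso_triple N N' g x y z : is_iso N N' g ->
  triple N x y z <-> triple N' (g x) (g y) (g z).
Proof.
move=> [_ gN]; rewrite /triple gN.
by have -> : [tuple of map g [tuple x; y; z]] = [tuple g x; g y; g z] by apply/val_inj.
Qed.

Lemma injective_surjective_bijective (h : nat -> nat) :
  injective h -> (forall y, exists x, h x = y) -> bijective h.
Proof.
move=> hI /choice[h' h'K]; exists h' => // x.
by apply: hI; rewrite h'K.
Qed.

(** * Decoding relative to a choice of 15 points *)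

Section Decoding.
Variables (L : language) (N : structures steiner_language) (d : nat -> nat).

Definition element (y : nat) : Prop :=
  (forall k, k < 15 -> y <> d k) /\ eqn N d 3 4 5 y.

Definition nth_element (n : nat) : nat := enumerate element n.

Definition decode : structures L := fun s w =>
  `[< eqn N d 6 7 8 (opcode N d (pickle s) (map nth_element w) (nth_element 0)) >].

Definition decode_hom : nat -> nat := theta_hom (rel_of decode) N d nth_element.

End Decoding.

Arguments decode L N d : clear implicits.

Section DecodeTheta.
Variables (L : language) (M : structures L) (N : structures steiner_language).
Variables (g d : nat -> nat).
Hypotheses (sN : steiner N) (gN : is_iso (theta (rel_of M)) N g).
Hypothesis gd : forall k, k < 15 -> d k = g (cst (rel_of M) k).

(** The decoded elements are enumerated in the order of [N], so the original structure is recovered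
    only up to the permutation [f]. *)
Lemma nth_element_bij : exists2 f, bijective f &
  forall n, nth_element N d n = g (elt (rel_of M) (f n)).
Proof.
have gI : injective g := bij_inj gN.1.
have inf n : exists2 m, n <= m & element N d m.
  apply: (@injective_unbounded _ (g \o elt (rel_of M))).
    by move=> x y /gI/elt_inj.
  by move=> x; apply/(iso_elt sN gN gd); exists x.
have /choice[f fE] n : exists x, nth_element N d n = g (elt (rel_of M) x).
  by apply/(iso_elt sN gN gd); apply: (enumerate_in inf n).
exists f => //; exists (fun x => rank (element N d) (g (elt (rel_of M) x))).
  by move=> n; rewrite -fE enumerateK.
move=> x; apply: (@elt_inj (rel_of M)); apply: gI; rewrite -fE /nth_element.
by rewrite rank_enumerate //; apply/(iso_elt sN gN gd); exists x.
Qed.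

Lemma decode_theta : exists2 f, is_iso (decode L N d) M f &
  is_iso (theta (rel_of (decode L N d))) N (decode_hom L N d).
Proof.
have [f bf fE] := nth_element_bij.
have gop := is_iso_op (steiner_theta _) sN gN.
have fM : is_iso (decode L N d) M f.
  split=> // s w; apply/asboolP/idP; rewrite (eq_map fE) fE.
    rewrite (map_comp (g \o elt (rel_of M)) f).
    by move/(iso_rel sN gN gd)/rel_of_pickle.
  move=> Msw; rewrite (map_comp (g \o elt (rel_of M)) f).
  by apply/(iso_rel sN gN gd); apply/(@rel_of_pickle _ M s [tuple of map f w]).
exists f => //; have fR := (is_iso_rel_of _ _ _).1 fM.
(* The canonical map and this composite agree on the constants and the elements, hence on all terms
   in normal form. *)
suff -> : decode_hom L N d = g \o lift (rel_of (decode L N d)) (rel_of M) f.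
  exact: is_iso_trans (lift_is_iso fR) gN.
apply/funext => n; rewrite /decode_hom /lift /theta_hom /=.
have := @nth_term_valid (rel_of (decode L N d)) n.
elim: (nth_term _ n) => [k k15|x _|t IHt u IHu] /=.
- exact: gd.
- exact: fE.
- by move=> [vt vu _ _]; rewrite gop IHt // IHu.
Qed.

End DecodeTheta.

Section BorelDecoding.
Variables (L : language) (d : nat -> nat).
Notation X := (models Sigma).

Lemma borel_op x y : borel_val (fun N : X => op (val N) x y).
Proof.
have -> : (fun N : X => op (val N) x y) =
    fun N : X => xget x [set z | triple (val N) x y z].
  by apply/funext => N; rewrite op.unlock.
apply: (@borel_val_xget X nat x (fun z N => triple (val N) x y z)).
  by move=> z; apply: (borel_fun_val (borel_atom _)).
move=> N i j; have [_ _ _ f _] := (models_SigmaP (val N)).1 (set_valP N).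
exact: f.
Qed.

Lemma borel_op2 (f h : X -> nat) : borel_val f -> borel_val h ->
  borel_val (fun N : X => op (val N) (f N) (h N)).
Proof.
move=> bf bh.
apply: (@borel_val_comp X nat nat f (fun x N => op (val N) x (h N)) bf) => x.
apply: (@borel_val_comp X nat nat h (fun y N => op (val N) x y) bh) => y.
exact: borel_op.
Qed.

Lemma borel_eqn a b c (f : X -> nat) : borel_val f ->
  borel (fun N : X => eqn (val N) d a b c (f N)).
Proof.
move=> bf; have bc k := @borel_val_cst X nat (d k).
by apply: (borel_op2 (borel_op2 bf (bc a)) (borel_op2 bf (bc b)) (d c)).
Qed.

Lemma borel_opcode i v (f : X -> nat) : borel_val f ->
  borel_val (fun N : X => opcode (val N) d i v (f N)).
Proof.
rewrite /opcode; elim: (_ ++ v) f => //= g l IH f bf.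
have bc k := @borel_val_cst X nat k.
apply: (IH (fun N : X => op (val N) (op (val N) (f N) g) (d 1))).
exact: (borel_op2 (borel_op2 bf (bc g)) (bc (d 1))).
Qed.

Lemma borel_nth_element n : borel_val (fun N : X => nth_element (val N) d n).
Proof.
apply: borel_enumerate => y; apply: borel_and; first exact: borel_const.
by apply: borel_eqn; apply: borel_val_cst.
Qed.

Lemma borel_map_nth_element v :
  borel_val (fun N : X => map (nth_element (val N) d) v).
Proof.
elim: v => [|n v IH]; first exact: borel_val_cst.
apply: (@borel_val_comp X nat (seq nat) (fun N => nth_element (val N) d n)
  (fun y N => y :: map (nth_element (val N) d) v)) => [|y].
  exact: borel_nth_element.
apply: (@borel_val_comp X _ (seq nat) (fun N => map (nth_element (val N) d) v)
  (fun l _ => y :: l)) => // l.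
exact: borel_val_cst.
Qed.

Lemma borel_decode_rel i v : borel (fun N : X =>
  eqn (val N) d 6 7 8 (opcode (val N) d i (map (nth_element (val N) d) v)
    (nth_element (val N) d 0))).
Proof.
apply: borel_eqn; apply: (@borel_val_comp X _ nat
  (fun N => map (nth_element (val N) d) v)
  (fun l N => opcode (val N) d i l (nth_element (val N) d 0))) => [|l].
  exact: borel_map_nth_element.
by apply: borel_opcode; apply: borel_nth_element.
Qed.

Lemma borel_fun_decode : borel_fun (fun N : X => decode L (val N) d).
Proof.
by apply: borel_fun_structures => s w; apply: borel_asbool; apply: borel_decode_rel.
Qed.

Lemma borel_rel_of (Y : topologicalType) (f : Y -> structures L) i v :
  borel_fun f -> borel (fun y => rel_of (f y) i v).
Proof.
move=> bf; do 2!apply: borel_exists => ?; apply: borel_and3; try exact: borel_const.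
exact: (bf _ (borel_atom _)).
Qed.

Lemma borel_eval t :
  borel_val (fun N : X => eval (val N) d (nth_element (val N) d) t).
Proof.
elim: t => [k|x|t IHt u IHu] /=; first exact: borel_val_cst.
  exact: borel_nth_element.
exact: borel_op2.
Qed.

Lemma borel_decode_hom n : borel_val (fun N : X => decode_hom L (val N) d n).
Proof.
have bR i v := borel_rel_of i v borel_fun_decode.
apply: (@borel_val_comp X _ nat
  (fun N => nth_term (rel_of (decode L (val N) d)) n)
  (fun t N => eval (val N) d (nth_element (val N) d) t)) => [|t].
  exact: borel_nth_term.
exact: borel_eval.
Qed.

(** Injectivity, surjectivity and preservation of triples quantify over natural numbers only. *)
Lemma borel_decode_iso : borel (fun N : X =>
  is_iso (theta (rel_of (decode L (val N) d))) (val N) (decode_hom L (val N) d)).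
Proof.
pose h (N : X) := decode_hom L (val N) d.
pose T (N : X) := theta (rel_of (decode L (val N) d)).
apply: (@borel_ext _ (fun N => [/\ forall x y, h N x = h N y -> x = y,
    forall y, exists x, h N x = y &
    forall x y z, triple (T N) x y z <-> triple (val N) (h N x) (h N y) (h N z)])).
  move=> N; split=> [[hI hS hT]|hN].
    by apply: triple_is_iso => //; apply: injective_surjective_bijective.
  have [h' hK h'K] := hN.1; split.
  - exact: can_inj hK.
  - by move=> y; exists (h' y); apply: h'K.
  - by move=> x y z; apply: is_iso_triple.
have bh x : borel_val (fun N => h N x) by exact: borel_decode_hom.
apply: borel_and3.
- do 2!apply: borel_forall => ?; apply: borel_imply; last exact: borel_const.
  apply: (@borel_subst X nat (fun N => h N _) (fun a N => a = h N _)) => // a.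
  by apply: borel_ext (bh _ a) => N; split=> ->.
- by apply: borel_forall => y; apply: borel_exists => x; apply: bh.
- do 3!apply: borel_forall => ?; apply: borel_iff.
    by apply: borel_triple_theta => i v; apply: borel_rel_of; apply: borel_fun_decode.
  apply: (@borel_subst X nat (fun N => h N _)
    (fun a N => triple (val N) a (h N _) (h N _))) => // a.
  apply: (@borel_subst X nat (fun N => h N _)
    (fun b N => triple (val N) a b (h N _))) => // b.
  apply: (@borel_subst X nat (fun N => h N _) (fun c N => triple (val N) a b c)) => // c.
  exact: (borel_fun_val (borel_atom _)).
Qed.

End BorelDecoding.

(** * Faithfulness of the coding *)

Section Reduction.
Variables (L : language) (s : sentence L).

Definition theta_models (M : models s) : models Sigma :=
  SigSub (mem_set ((models_SigmaP _).2 (steiner_theta (rel_of (val M))))).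

Lemma iso_theta (M M' : models s) : iso M M' <-> iso (theta_models M) (theta_models M').
Proof.
split=> -[g gM].
  by exists (lift (rel_of (val M)) (rel_of (val M')) g);
    apply/lift_is_iso/is_iso_rel_of.
by exists (restrict (rel_of (val M)) (rel_of (val M')) g);
  apply/is_iso_rel_of/restrict_rel_iso.
Qed.

Lemma borel_fun_theta_models : borel_fun theta_models.
Proof.
apply: borel_fun_sub; apply: borel_fun_theta => i v.
exact: borel_rel_of (@borel_fun_val _ _).
Qed.

(** The 15 points are given by a finite sequence, so that the quantifier over [d] is countable. The
    canonical map is required to be an isomorphism because decoding makes sense for any [N] and any
    [d]. *)
Lemma saturation_theta (A : set (models s)) : invariant_set (@iso L s) A ->
  saturation (@iso _ Sigma) (theta_models @` A) =
  [set N | exists d : seq nat,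
    is_iso (theta (rel_of (decode L (val N) (nth 0 d)))) (val N)
      (decode_hom L (val N) (nth 0 d)) /\
    (val @` A) (decode L (val N) (nth 0 d))].
Proof.
move=> Ainv; apply/seteqP; split=> N /=.
  move=> [_ [M AM <-] [h hN]].
  have sN := (models_SigmaP (val N)).1 (set_valP N).
  have [g hK gK] := hN.1; have gN := is_iso_inverse hN hK gK.
  (* The chosen points are the images of the rigid system under the isomorphism from the code of [M]
     to [N]. *)
  exists (mkseq (g \o cst (rel_of (val M))) 15).
  pose d := nth 0 (mkseq (g \o cst (rel_of (val M))) 15).
  have [k k15|f fM dN] := decode_theta sN gN (d := d).
    by rewrite /d nth_mkseq.
  split=> //; have [f' fK f'K] := fM.1.
  have f'M := is_iso_inverse fM fK f'K.
  have sD := is_iso_models f'M (set_valP M).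
  exists (SigSub (mem_set sD)) => //.
  (* The decoded structure is isomorphic to [M], and [A] is invariant. *)
  by apply: Ainv AM; exists f'.
move=> [d [dN [M AM ME]]]; exists (theta_models M); first by exists M.
have [h' hK h'K] := dN.1; exists h'; rewrite /= ME.
exact: is_iso_inverse dN hK h'K.
Qed.

Lemma theta_faithful :
  faithful_borel_reduction (@iso L s) (@iso _ Sigma) theta_models.
Proof.
split; first by split; [exact: borel_fun_theta_models|exact: iso_theta].
move=> A bA Ainv; rewrite saturation_theta //.
apply: borel_exists => d; apply: borel_and; first exact: borel_decode_iso.
(* Since the set of models of [s] is Borel, [A] is also Borel as a set of structures. *)
exact: (@borel_fun_decode L (nth 0 d) _ (borel_image_val (borel_models s) bA)).
Qed.

End Reduction.

(** * Automorphism groups *)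

Section Automorphisms.
Variables (L : language) (M : structures L).
Let R := rel_of M.

Lemma restrict_aut (g : Aut (theta R)) : is_iso M M (restrict R R (val g)).
Proof. exact/is_iso_rel_of/restrict_rel_iso/(set_valP g). Qed.

Lemma lift_aut (f : Aut M) : is_iso (theta R) (theta R) (lift R R (val f)).
Proof. exact/lift_is_iso/is_iso_rel_of/(set_valP f). Qed.

Definition aut_restrict (g : Aut (theta R)) : Aut M :=
  SigSub (mem_set (restrict_aut g)).

Definition aut_lift (f : Aut M) : Aut (theta R) :=
  SigSub (mem_set (lift_aut f)).

(** As [elt] is injective, it suffices to compare the images of elements under [g \o h]. *)
Lemma aut_restrictM : {morph aut_restrict : g h / (g * h)%g}.
Proof.
move=> g h; apply/val_inj/funext => x /=; apply: (@elt_inj R).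
rewrite -(restrictP (set_valP (g * h)%g)) -(restrictP (set_valP g)).
by rewrite -(restrictP (set_valP h)).
Qed.

HB.instance Definition _ :=
  isMultiplicative.Build (Aut (theta R)) (Aut M) aut_restrict aut_restrictM.

Lemma aut_theta : group_isomorphic (Aut (theta R)) (Aut M).
Proof.
exists aut_restrict; exists aut_lift.
- by move=> g; apply/val_inj/funext => n; apply: lift_restrict; apply: (set_valP g).
- by move=> f; apply/val_inj/funext => x; apply: restrict_lift.
Qed.

End Automorphisms.

Theorem mainTheorem1 :
  faithfully_borel_complete (@iso steiner_language Sigma) /\
  exists theta : models Gamma -> models Sigma,
    faithful_borel_reduction (@iso graph_language Gamma)
      (@iso steiner_language Sigma) theta /\
    forall M : models Gamma,
      group_isomorphic (Aut (val (theta M))) (Aut (val M)).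
Proof.
split; first by move=> L s; exists (@theta_models L s); apply: theta_faithful.
exists (@theta_models _ Gamma); split; first exact: theta_faithful.
by move=> M; apply: aut_theta.
Qed.
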